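(* Let $p(x)=a_dx^d+\cdots+a_1x$ be a polynomial with real coefficients, $d\geq2$, with $p(0)=0$ and $p'(0)=\lambda>1$. Suppose that $\mathcal{F}_\infty$, the Fatou component of $p$ containing $\infty$, contains an angular region $$W_\beta=\{z\in\mathbb{C}\setminus\{0\}: |\arg z|<\beta\}$$ for some $\beta>0$. Let $\Phi$ be the solution of $\Phi(\lambda z)=p(\Phi(z))$, $\Phi(0)=0$, $\Phi'(0)=1$. Then $\Phi$ is an entire function, and there is a function $F$, holomorphic and periodic with period $1$ on the strip $\{w\in\mathbb{C}: |\Im w|<\frac{\beta}{\log\lambda}\}$ and taking real values on the real axis, such that for every $\varepsilon>0$ and every $M>0$ $$\Phi(z)=\frac{1}{\sqrt[d-1]{a_d}}\exp\left(z^\rho F(\log_\lambda z)+o\left(|z|^{-M}\right)\right)$$ holds uniformly as $|z|\to\infty$ in $|\arg z|\leq\beta-\varepsilon$, where $\rho=\log_\lambda d$. Moreover, the real part of $z^\rho F(\log_\lambda z)$ is always positive (in this region).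
   Context: $\log_\lambda z=\frac{\log z}{\log\lambda}$ (principal branch). The Fatou set and Julia set of a polynomial are the standard notions from complex dynamics; $\mathcal{F}_\infty$ is the connected component of the Fatou set (in the Riemann sphere) containing $\infty$. *)

(* Defs.v *)
From HB Require Import structures.
From mathcomp Require Import all_boot all_order all_algebra.
From mathcomp Require Import all_classical all_reals all_analysis.
From mathcomp Require Export complex.
Import Order.TTheory GRing.Theory Num.Theory numFieldNormedType.Exports.

Set Implicit Arguments.
Unset Strict Implicit.
Unset Printing Implicit Defensive.

Local Open Scope ring_scope.
Local Open Scope classical_set_scope.
Local Open Scope complex_scope.

Section Defs.
Variable R : realType.

(** The complex plane, seen as a normed module (and topological space) over
    itself, so that [derivable] is complex differentiability. *)
Definition CC : normedModType R[i] := (R[i])^o.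

Definition holo_on (U : set CC) (f : CC -> CC) : Prop :=
  forall z, U z -> derivable f z 1.

Definition entire (f : CC -> CC) : Prop := forall z : CC, derivable f z 1.

Definition cabs (z : CC) : R := Normc.normc (z : R[i]).

(** principal argument, in (-pi, pi]  (arbitrary value 0 at z = 0) *)
Definition Arg (z : CC) : R :=
  if z == 0 then 0
  else if 0 <= complex.Im (z : R[i]) then acos (complex.Re (z : R[i]) / cabs z)
       else - acos (complex.Re (z : R[i]) / cabs z).

Definition cexp (w : CC) : CC :=
  ((expR (complex.Re (w : R[i]))) * cos (complex.Im (w : R[i])))
    +i* ((expR (complex.Re (w : R[i]))) * sin (complex.Im (w : R[i]))).

Definition clog (z : CC) : CC := (ln (cabs z)) +i* (Arg z).

Definition cpow (z : CC) (a : R) : CC := cexp ((a%:C : R[i]) * clog z).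

Definition clog_base (lam : R) (z : CC) : CC := clog z / (ln lam)%:C.

(** real (n)-th root of a real number (sign preserving; for odd n this is
    the unique real n-th root) *)
Definition real_root (n : nat) (a : R) : R :=
  Num.sg a * powR `|a| (n%:R)^-1.

Definition iterp (q : {poly R[i]}) (n : nat) (z : CC) : CC :=
  iter n (fun w : R[i] => q.[w]) z.

Definition lu_cvg (f : nat -> CC -> CC) (g : CC -> CC) (U : set CC) : Prop :=
  forall K : set CC, compact K -> K `<=` U ->
  forall e : R, 0 < e ->
  \forall n \near \oo, forall z, K z -> cabs (f n z - g z) < e.

Definition lu_div (f : nat -> CC -> CC) (U : set CC) : Prop :=
  forall K : set CC, compact K -> K `<=` U ->
  forall A : R,
  \forall n \near \oo, forall z, K z -> A < cabs (f n z).

Definition normal_family (fs : nat -> CC -> CC) (U : set CC) : Prop :=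
  forall s : nat -> nat, exists t : nat -> nat,
    (forall k, (t k < t k.+1)%N) /\
    ((exists g : CC -> CC, lu_cvg (fun k => fs (s (t k))) g U) \/
     lu_div (fun k => fs (s (t k))) U).

Definition fatou (q : {poly R[i]}) : set CC :=
  [set z | exists U : set CC, open U /\ U z /\ normal_family (iterp q) U].

(** finite part of the Fatou component containing infinity: the points z
    lying in some connected subset of the Fatou set that contains a
    neighbourhood {|w| > r} of infinity *)
Definition fatou_inf (q : {poly R[i]}) : set CC :=
  [set z | exists (S : set CC) (r : R),
      S `<=` fatou q /\ connected S /\ S z /\ [set w | r < cabs w] `<=` S].

Definition sector (b : R) : set CC :=
  [set z | z != 0 /\ `|Arg z| < b].

Definition hstrip (h : R) : set CC := [set w | `|complex.Im (w : R[i])| < h].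

End Defs.

(* Main.v *)
(** In the coordinate [z = lam ^ w] put [psi w = Phi (lam ^ w)], so that
    [psi (w + 1) = p (psi w)] and [psi] maps the strip [|Im w| < beta / ln lam] into
    the basin of infinity; there [psi] has no zeros and [c psi], with
    [c ^ (d - 1) = a_d], has a continuous logarithm [L], real on the real axis. Since
    [p x = a_d x ^ d Q (1 / x)] with [Q 0 = 1], we get
    [L (w + 1) = d L w + Log (Q (1 / psi w))] far to the right, so
    [G w = lim d ^ (- n) L (w + n)] exists, [G (w + 1) = d G w] and
    [L - G = O (1 / psi)], which decays faster than any power of [|z|]. The function [F]
    is [d ^ (- w) G w].

    No Cauchy theory is used. Distances along backward orbits of the repelling fixed point
    scale like [lam ^ n] up to a bounded factor, which makes [Phi] locally Lipschitz and
    real on the real axis; comparing the differences [L (x + n) - L (z + n)] for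
    consecutive [n] then yields Lipschitz bounds on the approximations of [G] that are
    strong enough to differentiate the limit. *)

(* Normality enters only once, to show that points of the Fatou component of infinity escape;
   afterwards the basin is described by one radius beyond which the polynomial at least doubles
   moduli.

   The hypothesis concerns points of a sector, while the proof needs the values of [Phi] on it.
   Since Phi(z) ~ z at 0, [Phi] nearly preserves directions there, and Phi(z) = p^n(Phi(lam^-n z))
   carries escape outwards. Reading off the principal argument of these values requires beta <= pi.

   The main obstacle is differentiating the limit [G]: uniform convergence gives nothing here
   without Cauchy estimates. Hence every error in the difference of two approximations is bounded by
   a multiple of that difference itself. This is possible because 1/psi = c exp(-L), so the
   correction Log Q(1/psi) is a function of [L] with a small Lipschitz constant wherever psi is
   large. *)
Require Import Defs.
From HB Require Import structures.
From mathcomp Require Import all_boot all_order all_algebra.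
From mathcomp Require Import all_classical all_reals all_analysis.
From mathcomp Require Import complex ring lra.
Import Order.TTheory GRing.Theory Num.Theory numFieldNormedType.Exports.
Local Open Scope ring_scope.
Local Open Scope classical_set_scope.
Local Open Scope complex_scope.

Set Implicit Arguments.
Unset Strict Implicit.
Unset Printing Implicit Defensive.

(** * Norm and differentiability on the complex plane *)
Section ComplexNorm.
Variable R : realType.
Local Notation C := R[i].
Local Notation N := (@Normc.normc R).
Local Notation Re := (@complex.Re R).
Local Notation Im := (@complex.Im R).
Implicit Types (x y z : C) (a b : R).

Lemma normc_sqrt z : N z = Num.sqrt (Re z ^+ 2 + Im z ^+ 2).
Proof. by case: z. Qed.

Lemma normc_ge0 z : 0 <= N z.
Proof. by rewrite normc_sqrt sqrtr_ge0. Qed.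

Lemma normc_sqr z : N z ^+ 2 = Re z ^+ 2 + Im z ^+ 2.
Proof. by rewrite normc_sqrt sqr_sqrtr// addr_ge0 ?sqr_ge0. Qed.

Lemma normc_gt0 z : (0 < N z) = (z != 0).
Proof.
rewrite lt_neqAle normc_ge0 andbT eq_sym; congr (~~ _); apply/eqP/eqP.
  exact: Normc.eq0_normc.
by move->; rewrite Normc.normc0.
Qed.

Lemma normc_add x y : N (x + y) <= N x + N y.
Proof. exact: le_normcD. Qed.

Lemma normc_opp x : N (- x) = N x.
Proof. exact: normcN. Qed.

Lemma normc_subC x y : N (x - y) = N (y - x).
Proof. by rewrite -normc_opp opprB. Qed.

Lemma normc_sub x y : N (x - y) <= N x + N y.
Proof. by rewrite -[N y]normc_opp normc_add. Qed.

Lemma normc_subl x y : N x - N y <= N (x - y).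
Proof. by rewrite lerBlDr -{1}(subrK y x) normc_add. Qed.

Lemma normc_dist x y z : N (x - z) <= N (x - y) + N (y - z).
Proof. by rewrite -{1}(subrK y x) -addrA normc_add. Qed.

Lemma normc_exp z n : N (z ^+ n) = N z ^+ n.
Proof. by elim: n => [|n IH]; rewrite ?Normc.normc1// !exprS Normc.normcM IH. Qed.

Lemma normc_real a : N a%:C = `|a|.
Proof. by rewrite normc_sqrt /= expr0n/= addr0 sqrtr_sqr. Qed.

Lemma normc_nat n : N n%:R = n%:R.
Proof. by rewrite -(rmorph_nat (real_complex R)) normc_real normr_nat. Qed.

Lemma ler_Re z : `|Re z| <= N z.
Proof.
by rewrite normc_sqrt -sqrtr_sqr ler_wsqrtr// lerDl sqr_ge0.
Qed.

Lemma ler_Im z : `|Im z| <= N z.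
Proof.
by rewrite normc_sqrt -sqrtr_sqr ler_wsqrtr// lerDr sqr_ge0.
Qed.

Lemma normc_le_sum z : N z <= `|Re z| + `|Im z|.
Proof.
rewrite -(@ler_pXn2r _ 2)// ?nnegrE ?normc_ge0 ?addr_ge0//.
rewrite normc_sqr sqrrD !real_normK ?num_real//.
by rewrite -addrA [X in _ <= _ + X]addrC addrA lerDl mulrn_wge0 ?mulr_ge0.
Qed.

Lemma normc_conj z : N (conjc z) = N z.
Proof. by case: z => a b; rewrite !normc_sqrt /= sqrrN. Qed.

Lemma ReD x y : Re (x + y) = Re x + Re y. Proof. by case: x; case: y. Qed.
Lemma ImD x y : Im (x + y) = Im x + Im y. Proof. by case: x; case: y. Qed.
Lemma ReN x : Re (- x) = - Re x. Proof. by case: x. Qed.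
Lemma ImN x : Im (- x) = - Im x. Proof. by case: x. Qed.
Lemma ReB x y : Re (x - y) = Re x - Re y. Proof. by rewrite ReD ReN. Qed.
Lemma ImB x y : Im (x - y) = Im x - Im y. Proof. by rewrite ImD ImN. Qed.
Lemma ReZ a x : Re (a%:C * x) = a * Re x.
Proof. by case: x => u v /=; rewrite mul0r subr0. Qed.
Lemma ImZ a x : Im (a%:C * x) = a * Im x.
Proof. by case: x => u v /=; rewrite mul0r addr0. Qed.

Lemma complex_ext x y : Re x = Re y -> Im x = Im y -> x = y.
Proof. by case: x => a b; case: y => c d /= -> ->. Qed.

Lemma complex_eta x : x = Re x +i* Im x. Proof. by case: x. Qed.

Lemma Im0_real z : Im z = 0 -> z = (Re z)%:C.
Proof. by case: z => a b /= ->. Qed.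

Lemma conjB x y : conjc (x - y) = conjc x - conjc y.
Proof. by case: x => a b; case: y => c d; apply: complex_ext => //=; ring. Qed.

Lemma conj_fixed z : conjc z = z -> Im z = 0.
Proof. case: z => a b [] /= h; lra. Qed.

Lemma real_conj z : Im z = 0 -> conjc z = z.
Proof. by case: z => a b /= ->; rewrite oppr0. Qed.

Lemma normc_small z : (forall e, 0 < e -> N z <= e) -> z = 0.
Proof.
move=> h; apply/eqP; apply: contraT; rewrite -normc_gt0 => z0.
have := h (N z / 2); lra.
Qed.

End ComplexNorm.

(** * Differentiability, local Lipschitz bounds and limits in epsilon-delta form *)

Section Calculus.
Variable R : realType.
Local Notation C := R[i].
Local Notation N := (@Normc.normc R).
Implicit Types (f g : C -> C) (z : C).

Definition ccont f z := forall e : R, 0 < e ->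
  exists2 d : R, 0 < d & forall x, N (x - z) < d -> N (f x - f z) < e.

(** The difference quotient multiplied out: the non-strict bound also covers [x = z], so punctured
    neighbourhoods appear only in the bridge to [derivable]. *)
Definition is_cdif f z (l : C) := forall e : R, 0 < e ->
  exists2 d : R, 0 < d & forall x, N (x - z) < d ->
    N (f x - f z - l * (x - z)) <= e * N (x - z).

Definition cdif f z := exists l, is_cdif f z l.

Definition llip f z := exists2 K : R, 0 <= K & exists2 d : R, 0 < d &
  forall x y, N (x - z) < d -> N (y - z) < d -> N (f x - f y) <= K * N (x - y).

Lemma llip_cont f z : llip f z -> ccont f z.
Proof.
move=> [K K0 [d d0 h]] e e0; exists (Num.min d (e / (K + 1))).
  by rewrite lt_min d0 divr_gt0// ltr_wpDl.
move=> x; rewrite lt_min => /andP[h1]; rewrite ltr_pdivlMr ?ltr_wpDl// => h2.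
apply: le_lt_trans (h x z h1 _) _; first by rewrite subrr Normc.normc0.
have := normc_ge0 (x - z) => n0.
have [n0'|n0'] := eqVneq (N (x - z)) 0; first by rewrite n0' mulr0.
nra.
Qed.

Lemma cdif_cont f z : cdif f z -> ccont f z.
Proof.
move=> [l h] e e0; have [d d0 hd] := h 1 ltr01.
have p0 : 0 < N l + 2 by rewrite ltr_wpDl ?normc_ge0.
exists (Num.min d (e / (N l + 2))).
  by rewrite lt_min d0 divr_gt0.
move=> x; rewrite lt_min => /andP[h1]; rewrite ltr_pdivlMr// => h2.
have n0 := normc_ge0 (x - z).
have := hd x h1; rewrite mul1r => h3.
have -> : f x - f z = (f x - f z - l * (x - z)) + l * (x - z) by ring.
apply: le_lt_trans (normc_add _ _) _; rewrite Normc.normcM.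
have [n0'|n0'] := eqVneq (N (x - z)) 0; first by nra.
nra.
Qed.

Lemma ccont_eq f g z (d : R) : 0 < d -> (forall x, N (x - z) < d -> f x = g x) ->
  ccont g z -> ccont f z.
Proof.
move=> d0 fg h e e0; have [d' d'0 h'] := h e e0.
exists (Num.min d d'); first by rewrite lt_min d0.
move=> x; rewrite lt_min => /andP[h1 h2]; rewrite !fg ?subrr ?Normc.normc0//.
exact: h'.
Qed.

Lemma is_cdif_eq f g z l (d : R) : 0 < d -> (forall x, N (x - z) < d -> f x = g x) ->
  is_cdif g z l -> is_cdif f z l.
Proof.
move=> d0 fg h e e0; have [d' d'0 h'] := h e e0.
exists (Num.min d d'); first by rewrite lt_min d0.
move=> x; rewrite lt_min => /andP[h1 h2]; rewrite !fg ?subrr ?Normc.normc0//.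
exact: h'.
Qed.

Lemma cdif_eq f g z (d : R) : 0 < d -> (forall x, N (x - z) < d -> f x = g x) ->
  cdif g z -> cdif f z.
Proof. by move=> d0 fg [l h]; exists l; exact: is_cdif_eq d0 fg h. Qed.

Lemma ccont_cst c z : ccont (fun=> c) z.
Proof. by move=> e e0; exists 1 => // x _; rewrite subrr Normc.normc0. Qed.

Lemma ccont_id z : ccont id z.
Proof. by move=> e e0; exists e. Qed.

Lemma ccontD f g z : ccont f z -> ccont g z -> ccont (fun x => f x + g x) z.
Proof.
move=> hf hg e e0; have e2 : 0 < e / 2 by lra.
have [d1 d10 h1] := hf _ e2; have [d2 d20 h2] := hg _ e2.
exists (Num.min d1 d2); first by rewrite lt_min d10.
move=> x; rewrite lt_min => /andP[/h1 k1 /h2 k2].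
have -> : f x + g x - (f z + g z) = (f x - f z) + (g x - g z) by ring.
by apply: le_lt_trans (normc_add _ _) _; lra.
Qed.

Lemma ccont_comp f g z : ccont g z -> ccont f (g z) -> ccont (fun x => f (g x)) z.
Proof.
move=> hg hf e e0; have [d d0 h] := hf _ e0; have [d' d'0 h'] := hg _ d0.
by exists d' => // x /h' /h.
Qed.

Lemma ccontM f g z : ccont f z -> ccont g z -> ccont (fun x => f x * g x) z.
Proof.
move=> hf hg e e0.
set K := N (f z) + N (g z) + 1.
have K0 : 0 < K by rewrite /K ltr_wpDl// addr_ge0 ?normc_ge0.
have KK0 : 0 < K + K by lra.
have e2 : 0 < Num.min 1 (e / (K + K)) by rewrite lt_min ltr01 divr_gt0.
have [d1 d10 h1] := hf _ e2; have [d2 d20 h2] := hg _ e2.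
exists (Num.min d1 d2); first by rewrite lt_min d10.
move=> x; rewrite lt_min => /andP[/h1 + /h2].
rewrite !lt_min !ltr_pdivlMr// => /andP[k1 k2] /andP[k3 k4].
have -> : f x * g x - f z * g z = (f x - f z) * (g x - g z) + f z * (g x - g z)
  + (f x - f z) * g z by ring.
apply: le_lt_trans (normc_add _ _) _.
apply: le_lt_trans (lerD (normc_add _ _) (lexx _)) _; rewrite !Normc.normcM.
have a0 := normc_ge0 (f x - f z); have b0 := normc_ge0 (g x - g z).
have c0 := normc_ge0 (f z); have d0 := normc_ge0 (g z).
rewrite -(@ltr_pM2r _ 2)//; rewrite /K in k2 k4; nra.
Qed.

Lemma ccontV f z : f z != 0 -> ccont f z -> ccont (fun x => (f x)^-1) z.
Proof.
rewrite -normc_gt0 => fz hf e e0.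
have e2 : 0 < Num.min (N (f z) / 2) (e * (N (f z) ^+ 2 / 2)).
  by rewrite lt_min divr_gt0//= mulr_gt0// divr_gt0// exprn_gt0.
have [d d0 h] := hf _ e2; exists d => // x /h; rewrite lt_min => /andP[k1 k2].
have fx : N (f z) / 2 < N (f x).
  by have := normc_subl (f z) (f x); rewrite normc_subC; lra.
have fx0 : f x != 0 by rewrite -normc_gt0; lra.
have fz0 : f z != 0 by rewrite -normc_gt0.
have -> : (f x)^-1 - (f z)^-1 = - ((f x - f z) / (f x * f z)) by field; rewrite fx0 fz0.
rewrite normc_opp Normc.normcM Normc.normcV Normc.normcM ltr_pdivrMr; last first.
  by rewrite mulr_gt0// normc_gt0.
apply: lt_le_trans k2 _; rewrite expr2 ler_pM2l//; nra.
Qed.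

Lemma ccont_sum n (f : nat -> C -> C) z : (forall k, (k < n)%N -> ccont (f k) z) ->
  ccont (fun x => \sum_(k < n) f k x) z.
Proof.
elim: n => [|n IH] h.
  apply: (ccont_eq ltr01 (g := fun=> 0)) => [x _|]; [by rewrite big_ord0|exact: ccont_cst].
apply: (ccont_eq ltr01 (g := fun x => \sum_(k < n) f k x + f n x)) => [x _|].
  by rewrite big_ord_recr.
by apply: ccontD; [apply: IH => k /ltnW; exact: h|exact: h].
Qed.

Lemma is_cdif_cst c z : is_cdif (fun=> c) z 0.
Proof.
by move=> e e0; exists 1 => // x _; rewrite subrr mul0r subr0 Normc.normc0 mulr_ge0 ?normc_ge0 ?ltW.
Qed.

Lemma is_cdif_id z : is_cdif id z 1.
Proof.
by move=> e e0; exists 1 => // x _; rewrite mul1r subrr Normc.normc0 mulr_ge0 ?normc_ge0 ?ltW.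
Qed.

Lemma is_cdifD f g z l m : is_cdif f z l -> is_cdif g z m ->
  is_cdif (fun x => f x + g x) z (l + m).
Proof.
move=> hf hg e e0; have e2 : 0 < e / 2 by lra.
have [d1 d10 h1] := hf _ e2; have [d2 d20 h2] := hg _ e2.
exists (Num.min d1 d2); first by rewrite lt_min d10.
move=> x; rewrite lt_min => /andP[/h1 k1 /h2 k2].
have -> : f x + g x - (f z + g z) - (l + m) * (x - z)
  = (f x - f z - l * (x - z)) + (g x - g z - m * (x - z)) by ring.
by apply: le_trans (normc_add _ _) _; lra.
Qed.

Lemma is_cdif_comp f g z l m : is_cdif g z m -> is_cdif f (g z) l ->
  is_cdif (fun x => f (g x)) z (l * m).
Proof.
move=> hg hf e e0.
have l0 := normc_ge0 l; have m0 := normc_ge0 m.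
have p1 : 0 < N m + 1 by lra.
have p2 : 0 < N l + 1 by lra.
have e1 : 0 < e / 2 / (N m + 1) by rewrite !divr_gt0.
have e2 : 0 < Num.min 1 (e / 2 / (N l + 1)) by rewrite lt_min ltr01 !divr_gt0.
have [d1 d10 h1] := hf _ e1; have [d2 d20 h2] := hg _ e2.
have [d3 d30 h3] := cdif_cont (ex_intro _ _ hg) d10.
exists (Num.min d2 d3); first by rewrite lt_min d20.
move=> x; rewrite lt_min => /andP[/h2 k2 /h3 /h1 k1].
set u := g x - g z in k1 k2; set h := x - z in k2 *.
have -> : f (g x) - f (g z) - l * m * h =
  (f (g x) - f (g z) - l * u) + l * (u - m * h) by ring.
apply: le_trans (normc_add _ _) _; rewrite Normc.normcM.
have nu : N u <= (N m + 1) * N h.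
  have -> : u = (u - m * h) + m * h by ring.
  apply: le_trans (normc_add _ _) _; rewrite Normc.normcM.
  have := normc_ge0 h.
  have : Num.min 1 (e / 2 / (N l + 1)) <= 1 by rewrite ge_min lexx.
  nra.
have k1' : N (f (g x) - f (g z) - l * u) <= e / 2 * N h.
  apply: le_trans k1 _; rewrite -mulrA ler_pM2l ?divr_gt0//.
  by rewrite mulrC ler_pdivrMr// mulrC.
have k2' : N l * N (u - m * h) <= e / 2 * N h.
  apply: (@le_trans _ _ ((N l + 1) * (e / 2 / (N l + 1) * N h))).
    apply: ler_pM; rewrite ?normc_ge0 ?lerDl//.
    apply: le_trans k2 _; apply: ler_wpM2r; rewrite ?normc_ge0//.
    by rewrite ge_min lexx orbT.
  by rewrite mulrA [X in X * _](mulrC) divfK// gt_eqF.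
lra.
Qed.

Lemma is_cdifM f g z l m : is_cdif f z l -> is_cdif g z m ->
  is_cdif (fun x => f x * g x) z (l * g z + f z * m).
Proof.
move=> hf hg e e0.
have p1 : 0 < N (g z) + N (f z) + N l + 1 by rewrite ltr_wpDl// !addr_ge0 ?normc_ge0.
have e1 : 0 < e / (N (g z) + N (f z) + N l + 1) by rewrite divr_gt0.
set e' := e / _ in e1.
have [d1 d10 h1] := hf _ e1; have [d2 d20 h2] := hg _ e1.
have e1' : 0 < Num.min 1 e' by rewrite lt_min ltr01.
have [d3 d30 h3] := cdif_cont (ex_intro _ _ hg) e1'.
exists (Num.min d1 (Num.min d2 d3)); first by rewrite !lt_min d10 d20.
move=> x; rewrite !lt_min => /andP[/h1 k1 /andP[/h2 k2 /h3]].
rewrite lt_min => /andP[k3 k4].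
set h := x - z in k1 k2 *.
have -> : f x * g x - f z * g z - (l * g z + f z * m) * h =
 (f x - f z - l * h) * g z + (f z * (g x - g z - m * h) +
 ((f x - f z - l * h) * (g x - g z) + l * h * (g x - g z))) by ring.
apply: le_trans (normc_add _ _) _; rewrite !Normc.normcM.
apply: le_trans (lerD (lexx _) (normc_add _ _)) _.
apply: le_trans (lerD (lexx _) (lerD (lexx _) (normc_add _ _))) _.
rewrite !Normc.normcM.
have -> : e = e' * N (g z) + (e' * N (f z) + (e' * 1 + N l * e')).
  by rewrite /e'; field; rewrite gt_eqF.
rewrite !mulrDl.
have H1 : N (f x - f z - l * h) * N (g z) <= e' * N (g z) * N h.
  by rewrite mulrAC ler_wpM2r ?normc_ge0.
have H2 : N (f z) * N (g x - g z - m * h) <= e' * N (f z) * N h.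
  by rewrite mulrAC mulrC ler_wpM2r ?normc_ge0.
have H3 : N (f x - f z - l * h) * N (g x - g z) <= e' * 1 * N h.
  by rewrite mulrAC; apply: ler_pM; rewrite ?normc_ge0//; exact: ltW.
have H4 : N l * N h * N (g x - g z) <= N l * e' * N h.
  by rewrite mulrAC ler_wpM2r ?normc_ge0// ler_wpM2l ?normc_ge0// ltW.
lra.
Qed.

Lemma cdif_cst c z : cdif (fun=> c) z.
Proof. by exists 0; exact: is_cdif_cst. Qed.
Lemma cdif_id z : cdif id z.
Proof. by exists 1; exact: is_cdif_id. Qed.
Lemma cdifD f g z : cdif f z -> cdif g z -> cdif (fun x => f x + g x) z.
Proof. by move=> [l hl] [m hm]; exists (l + m); exact: is_cdifD. Qed.
Lemma cdifM f g z : cdif f z -> cdif g z -> cdif (fun x => f x * g x) z.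
Proof. by move=> [l hl] [m hm]; eexists; exact: is_cdifM hl hm. Qed.
Lemma cdif_comp f g z : cdif g z -> cdif f (g z) -> cdif (fun x => f (g x)) z.
Proof. by move=> [m hm] [l hl]; eexists; exact: is_cdif_comp hm hl. Qed.

Lemma cdif_poly (p : {poly C}) z : cdif (horner p) z.
Proof.
elim/poly_ind: p => [|p c IH].
  by apply: (cdif_eq ltr01 (g := fun=> 0)) (cdif_cst _ _) => x _; rewrite horner0.
apply: (cdif_eq ltr01 (g := fun x => p.[x] * x + c)) => [x _|].
  by rewrite !hornerE.
by apply: cdifD (cdif_cst _ _); apply: cdifM (cdif_id _).
Qed.

Lemma llip_comp f g z : llip g z -> llip f (g z) -> llip (fun x => f (g x)) z.
Proof.
move=> hg [L L0 [e e0 h']].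
have [d' d'0 hd'] := llip_cont hg e0; case: hg => K K0 [d d0 h].
exists (L * K); first by rewrite mulr_ge0.
exists (Num.min d d'); first by rewrite lt_min d0.
move=> x y; rewrite !lt_min => /andP[x1 x2] /andP[y1 y2].
apply: le_trans (h' _ _ (hd' _ x2) (hd' _ y2)) _.
by rewrite -mulrA ler_wpM2l// h.
Qed.

Lemma llip_eq f g z (d : R) : 0 < d -> (forall x, N (x - z) < d -> f x = g x) ->
  llip g z -> llip f z.
Proof.
move=> d0 fg [K K0 [e e0 h]]; exists K => //; exists (Num.min d e).
  by rewrite lt_min d0.
move=> x y; rewrite !lt_min => /andP[x1 x2] /andP[y1 y2].
by rewrite !fg// h.
Qed.

Lemma cseq_cauchy (u : nat -> C) (K : R) :
  (forall k, N (u k.+1 - u k) <= K * 2^-1 ^+ k) ->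
  exists l, forall k, N (u k - l) <= 4 * (K * 2^-1 ^+ k).
Proof.
have half (v : nat -> R) : (forall k, `|v k.+1 - v k| <= K * 2^-1 ^+ k) ->
    exists l, forall k, `|v k - l| <= 2 * (K * 2^-1 ^+ k).
  move=> hv.
  have K0 : 0 <= K by have := le_trans (normr_ge0 _) (hv 0%N); rewrite expr0 mulr1.
  (* The geometric tail from k on is 2 K 2^-k, so the intervals [lo k, hi k] are nested and the
     supremum of their left ends lies in all of them. *)
  pose lo k := v k - 2 * (K * 2^-1 ^+ k); pose hi k := v k + 2 * (K * 2^-1 ^+ k).
  have lolo k n : lo k <= lo (k + n)%N.
    elim: n => [|n IH]; first by rewrite addn0.
    apply: le_trans IH _; rewrite addnS /lo exprS.
    by have := hv (k + n)%N; rewrite ler_norml => /andP[]; lra.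
  have hihi k n : hi (k + n)%N <= hi k.
    elim: n => [|n IH]; first by rewrite addn0.
    apply: le_trans IH; rewrite addnS /hi exprS.
    by have := hv (k + n)%N; rewrite ler_norml => /andP[]; lra.
  have lohi n m : lo n <= hi m.
    apply: le_trans (lolo n m) _; apply: le_trans (hihi m n); rewrite addnC /lo /hi.
    have : 0 <= K * 2^-1 ^+ (m + n) by rewrite mulr_ge0 ?exprn_ge0 ?invr_ge0.
    lra.
  have S : has_sup (range lo).
    by split; [exists (lo 0%N), 0%N|exists (hi 0%N) => _ [n _ <-]].
  exists (sup (range lo)) => k; rewrite ler_norml.
  have h1 : lo k <= sup (range lo) by apply: sup_upper_bound => //; exists k.
  have h2 : sup (range lo) <= hi k by apply: ge_sup => [|_ [n _ <-]]//; exists (lo 0%N), 0%N.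
  by move: h1 h2; rewrite /lo /hi => h1 h2; apply/andP; split; lra.
move=> hu.
have hr k : `|complex.Re (u k.+1) - complex.Re (u k)| <= K * 2^-1 ^+ k.
  by rewrite -ReB; exact: le_trans (ler_Re _) (hu k).
have hi k : `|complex.Im (u k.+1) - complex.Im (u k)| <= K * 2^-1 ^+ k.
  by rewrite -ImB; exact: le_trans (ler_Im _) (hu k).
have [a ha] := half (fun k => complex.Re (u k)) hr.
have [b hb] := half (fun k => complex.Im (u k)) hi.
exists (a +i* b) => k; apply: le_trans (normc_le_sum _) _; rewrite ReB ImB /=.
by have := ha k; have := hb k; lra.
Qed.

Lemma exp2_small (K e : R) : 0 < e -> exists k, K * 2^-1 ^+ k < e.
Proof.
move=> e0; pose n := Num.bound (`|K| / e); exists n.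
have h : `|K| / e < n%:R.
  by apply: archi_boundP; rewrite divr_ge0// ltW.
have h2 : (n%:R : R) < 2 ^+ n by rewrite -natrX ltr_nat ltn_expl.
rewrite exprVn ltr_pdivrMr ?exprn_gt0// mulrC -ltr_pdivrMr//.
apply: le_lt_trans (lt_trans h h2); rewrite ler_pM2r ?invr_gt0//; exact: ler_norm.
Qed.

(** Because the error is measured against [N (x - z)], each single [f k] determines the difference
    quotients of [G] at z up to K 2^-k. The derivatives of the [f k] at z are therefore Cauchy, and
    their limit is the derivative of [G]. *)
Lemma cdif_limit (G : C -> C) (f : nat -> C -> C) z (K d : R) : 0 <= K -> 0 < d ->
  (forall k, cdif (f k) z) ->
  (forall k x, N (x - z) < d ->
    N (G x - G z - (f k x - f k z)) <= K * 2^-1 ^+ k * N (x - z)) ->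
  cdif G z.
Proof.
move=> K0 d0 hf hG.
have /choice [D hD] : forall k, exists l, is_cdif (f k) z l by move=> k; exact: hf.
have cau k : N (D k.+1 - D k) <= 2 * K * 2^-1 ^+ k.
  apply/ler_addgt0Pr => e e0.
  have e2 : 0 < e / 2 by lra.
  have [d1 d10 h1] := hD k _ e2; have [d2 d20 h2] := hD k.+1 _ e2.
  (* A test point z + t inside all neighbourhoods; dividing by t compares the derivatives of [f k]
     and [f k.+1] through [G]. *)
  pose t := Num.min d (Num.min d1 d2) / 2.
  have t0 : 0 < t by rewrite divr_gt0// !lt_min d0 d10 d20.
  have tm : t < Num.min d (Num.min d1 d2).
    by rewrite /t ltr_pdivrMr// ltr_pMr ?ltr1n// !lt_min d0 d10 d20.
  move: tm; rewrite !lt_min => /and3P[td td1 td2].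
  pose x := z + t%:C.
  have xz : x - z = t%:C by rewrite /x addrAC subrr add0r.
  have nx : N (x - z) = t by rewrite xz normc_real gtr0_norm.
  move: (h1 x) (h2 x) (hG k x) (hG k.+1 x); rewrite !nx => /(_ td1) H1 /(_ td2) H2 /(_ td) H3 /(_ td) H4.
  rewrite -(ler_pM2r t0) -{1}nx -Normc.normcM.
  have -> : (D k.+1 - D k) * (x - z) = (f k x - f k z - D k * (x - z)) +
    ((G x - G z - (f k x - f k z)) - ((f k.+1 x - f k.+1 z - D k.+1 * (x - z))
     + (G x - G z - (f k.+1 x - f k.+1 z)))) by ring.
  apply: le_trans (normc_add _ _) _.
  apply: le_trans (lerD (lexx _) (normc_sub _ _)) _.
  apply: le_trans (lerD (lexx _) (lerD (lexx _) (normc_add _ _))) _.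
  have : K * 2^-1 ^+ k.+1 * t <= K * 2^-1 ^+ k * t.
    rewrite ler_pM2r// ler_wpM2l// exprS ler_piMl ?exprn_ge0 ?invr_ge0//; lra.
  lra.
have [l hl] := cseq_cauchy cau; exists l => e e0.
have e4 : 0 < e / 2 by lra.
have [k hk] := exp2_small (K + 4 * (2 * K)) e4.
have [d1 d10 h1] := hD k _ e4.
exists (Num.min d d1); first by rewrite lt_min d0.
move=> x; rewrite lt_min => /andP[/(hG k) H1 /h1 H2].
have -> : G x - G z - l * (x - z) = (G x - G z - (f k x - f k z)) +
  ((f k x - f k z - D k * (x - z)) + (D k - l) * (x - z)) by ring.
apply: le_trans (normc_add _ _) _.
apply: le_trans (lerD (lexx _) (normc_add _ _)) _; rewrite Normc.normcM.
have H3 : N (D k - l) * N (x - z) <= 4 * (2 * K * 2^-1 ^+ k) * N (x - z).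
  by rewrite ler_wpM2r ?normc_ge0.
have H4 : (K + 4 * (2 * K)) * 2^-1 ^+ k * N (x - z) <= e / 2 * N (x - z).
  by rewrite ler_wpM2r ?normc_ge0// ltW.
lra.
Qed.

Lemma poly_ball_bound (p : {poly C}) (r : R) : exists2 K : R, 0 <= K &
  forall x, N x <= r -> N p.[x] <= K.
Proof.
elim/poly_ind: p => [|p c [K K0 h]].
  by exists 0 => // x _; rewrite horner0 Normc.normc0.
exists (K * `|r| + N c); first by rewrite addr_ge0 ?mulr_ge0 ?normc_ge0.
move=> x xr; rewrite !hornerE; apply: le_trans (normc_add _ _) _.
rewrite Normc.normcM lerD2r ler_pM ?normc_ge0 ?h//.
by apply: le_trans xr (ler_norm _).
Qed.

Lemma poly_ball_lip (p : {poly C}) (r : R) : exists2 K : R, 0 <= K &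
  forall x y, N x <= r -> N y <= r -> N (p.[x] - p.[y]) <= K * N (x - y).
Proof.
elim/poly_ind: p => [|p c [K K0 h]].
  by exists 0 => // x y _ _; rewrite !horner0 subrr Normc.normc0 mul0r.
have [M M0 hM] := poly_ball_bound p r.
exists (K * `|r| + M); first by rewrite addr_ge0 ?mulr_ge0.
move=> x y xr yr; rewrite !hornerE.
have -> : p.[x] * x + c - (p.[y] * y + c) = (p.[x] - p.[y]) * x + p.[y] * (x - y) by ring.
apply: le_trans (normc_add _ _) _; rewrite !Normc.normcM mulrDl.
apply: lerD; last by rewrite ler_wpM2r ?normc_ge0 ?hM.
rewrite mulrAC; apply: ler_pM; rewrite ?normc_ge0 ?h//.
by apply: le_trans xr (ler_norm _).
Qed.

Lemma llip_poly (p : {poly C}) z : llip (horner p) z.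
Proof.
have [K K0 h] := poly_ball_lip p (N z + 1); exists K => //; exists 1 => //.
have b x : N (x - z) < 1 -> N x <= N z + 1.
  by have := normc_subl x z; lra.
by move=> x y /b xb /b yb; exact: h.
Qed.

End Calculus.

(** * The exponential *)
Section RealBounds.
Variable R : realType.
Implicit Types (f : R -> R) (x y : R).

Lemma MVT0_bound f (df : R -> R) y (K : R) :
  (forall x : R, is_derive x (1 : R) f (df x)) ->
  (forall c, `|c| <= `|y| -> `|df c| <= K) -> `|f y - f 0| <= K * `|y|.
Proof.
move=> fd dfK.
have cf (A : set R) : {within A, continuous f}.
  apply: continuous_subspaceT => x; apply: differentiable_continuous.
  by apply/derivable1_diffP; have := fd x => -[].
have [y0|y0|->] := ltgtP y 0; last by rewrite subrr normr0 mulr0.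
- have [c] := MVT y0 (fun x _ => fd x) (cf _); rewrite in_itv/= => /andP[yc c0] e.
  rewrite -normrN opprB e sub0r normrM normrN ler_wpM2r//; apply: dfK.
  by rewrite !ltr0_norm// lerN2 ltW.
- have [c] := MVT y0 (fun x _ => fd x) (cf _); rewrite in_itv/= => /andP[c0 yc] e.
  rewrite e subr0 normrM ler_wpM2r//; apply: dfK.
  by rewrite !gtr0_norm// ltW.
Qed.

Lemma abs_sin_le y : `|sin y| <= `|y|.
Proof.
have := @MVT0_bound _ _ y 1 (@is_derive_sin R) (fun c _ => cos_max c).
by rewrite sin0 subr0 mul1r.
Qed.

Lemma cos_halfE y : 1 - cos y = 2 * sin (y / 2) ^+ 2.
Proof.
have e : y = (y / 2) *+ 2 by rewrite mulr2n; lra.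
rewrite {1}e cos_mulr2n cos2sin2; ring.
Qed.

Lemma abs_cos1_le y : `|cos y - 1| <= `|y|.
Proof.
rewrite -normrN opprB cos_halfE normrM normrX normr_nat.
have := abs_sin_le (y / 2); rewrite normrM normfV normr_nat => h1.
have := sin_max (y / 2); have := normr_ge0 (sin (y / 2)).
by rewrite expr2; nra.
Qed.

Lemma abs_cos1_le2 y : `|cos y - 1| <= `|y| ^+ 2.
Proof.
rewrite -normrN opprB cos_halfE normrM normrX normr_nat.
have := abs_sin_le (y / 2); rewrite normrM normfV normr_nat => h1.
by have := normr_ge0 (sin (y / 2)); nra.
Qed.

Lemma abs_sinB_le y : `|sin y - y| <= `|y| ^+ 2.
Proof.
have D (x : R) : is_derive x (1 : R) (fun t => sin t - t) (cos x - 1).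
  exact: is_deriveB.
have := @MVT0_bound _ _ y `|y| D (fun c h => le_trans (abs_cos1_le c) h).
by rewrite sin0 !subr0 expr2.
Qed.

Lemma abs_atan_le y : `|atan y| <= `|y|.
Proof.
have h c : `|c| <= `|y| -> `|(1 + c ^+ 2)^-1| <= 1.
  move=> _; have c2 := sqr_ge0 c.
  by rewrite ger0_norm ?invr_ge0 ?addr_ge0// invf_le1 ?lerDl// ltr_wpDr.
by have := MVT0_bound (@is_derive1_atan R) h; rewrite atan0 subr0 mul1r.
Qed.

Lemma expR_le_inv x : x < 1 -> expR x * (1 - x) <= 1.
Proof.
move=> x1; have := expR_ge1Dx (- x); rewrite -(@ler_pM2l _ (expR x)) ?expR_gt0//.
by rewrite expRxMexpNx_1.
Qed.

Lemma expR_lin_bound x : `|x| <= 1 / 2 -> `|expR x - 1| <= 2 * `|x|.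
Proof.
rewrite ler_norml => /andP[x1 x2].
have h1 := expR_ge1Dx x; have h2 : expR x * (1 - x) <= 1 by apply: expR_le_inv; lra.
have h3 := expR_gt0 x.
by rewrite ler_norml; have [x0|x0] := ger0P x; apply/andP; split; nra.
Qed.

Lemma expR_quad_bound x : `|x| <= 1 / 2 -> `|expR x - 1 - x| <= 2 * `|x| ^+ 2.
Proof.
move=> xh; have h4 := expR_lin_bound xh.
have H : x * (expR x - 1) <= 2 * `|x| ^+ 2.
  apply: le_trans (ler_norm _) _; rewrite normrM expr2 mulrCA.
  by rewrite ler_wpM2l.
have h1 := expR_ge1Dx x; have h2 : expR x * (1 - x) <= 1.
  by apply: expR_le_inv; have := ler_norm x; lra.
by rewrite ger0_norm; lra.
Qed.

End RealBounds.

(** * The complex exponential and uniqueness of continuous lifts *)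

Section ComplexExp.
Variable R : realType.
Local Notation C := R[i].
Local Notation N := (@Normc.normc R).
Local Notation Re := (@complex.Re R).
Local Notation Im := (@complex.Im R).
Implicit Types (x y z w : C).

(** The same function as [cexp], retyped from the normed module [CC] to the field [R[i]]. *)
Definition Cexp : C -> C := @cexp R.

Lemma CexpE z : Cexp z = (expR (Re z) * cos (Im z)) +i* (expR (Re z) * sin (Im z)).
Proof. by []. Qed.

Lemma Cexp0 : Cexp 0 = 1.
Proof. by rewrite CexpE /= expR0 cos0 sin0 mulr1 mulr0. Qed.

Lemma CexpD x y : Cexp (x + y) = Cexp x * Cexp y.
Proof.
rewrite !CexpE ReD ImD expRD cosD sinD; apply: complex_ext => /=; ring.
Qed.

Lemma normc_Cexp z : N (Cexp z) = expR (Re z).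
Proof.
rewrite normc_sqrt CexpE /= !exprMn -mulrDr cos2Dsin2 mulr1 sqrtr_sqr.
by rewrite ger0_norm ?expR_ge0.
Qed.

Lemma Cexp_neq0 z : Cexp z != 0.
Proof. by rewrite -normc_gt0 normc_Cexp expR_gt0. Qed.

Lemma CexpN z : Cexp (- z) = (Cexp z)^-1.
Proof.
have n0 := Cexp_neq0 z.
by apply: (mulIf n0); rewrite mulVf// -CexpD addNr Cexp0.
Qed.

Lemma CexpB x y : Cexp (x - y) = Cexp x / Cexp y.
Proof. by rewrite CexpD CexpN. Qed.

Lemma Cexp_nat n z : Cexp (n%:R * z) = Cexp z ^+ n.
Proof.
elim: n => [|n IH]; first by rewrite mul0r Cexp0.
by rewrite mulrSr mulrDl mul1r CexpD IH exprSr.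
Qed.

Lemma Cexp_sum n (f : nat -> C) : Cexp (\sum_(k < n) f k) = \prod_(k < n) Cexp (f k).
Proof.
by elim: n => [|n IH]; rewrite ?big_ord0 ?Cexp0// !big_ord_recr /= CexpD IH.
Qed.

Lemma Cexp_real (a : R) : Cexp a%:C = (expR a)%:C.
Proof. by rewrite CexpE /= cos0 sin0 mulr1 mulr0. Qed.

Lemma Cexp_conj z : Cexp (conjc z) = conjc (Cexp z).
Proof. by case: z => a b; rewrite !CexpE /= cosN sinN mulrN. Qed.

(** On the left half-plane the exponential has modulus at most 1, so the linear bound needs no
    smallness of z. *)
Lemma Cexp_sub1_le z : Re z <= 0 -> N (Cexp z - 1) <= 3 * N z.
Proof.
move=> z0; apply: le_trans (normc_le_sum _) _; rewrite ReB ImB CexpE /= subr0.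
have e1 : expR (Re z) <= 1 by rewrite -expR0 ler_expR.
have e0 := expR_gt0 (Re z); have ex := expR_ge1Dx (Re z).
have c1 := abs_cos1_le (Im z); have s1 := abs_sin_le (Im z).
have rz := ler_Re z; have iz := ler_Im z.
have -> : expR (Re z) * cos (Im z) - 1 = expR (Re z) * (cos (Im z) - 1) + (expR (Re z) - 1) by ring.
have H1 : `|expR (Re z) * (cos (Im z) - 1)| <= `|Im z|.
  rewrite normrM (gtr0_norm e0); have := normr_ge0 (cos (Im z) - 1); nra.
have H2 : `|expR (Re z) - 1| <= `|Re z|.
  by rewrite [leRHS]ler0_norm// ler0_norm ?subr_le0//; lra.
have H3 : `|expR (Re z) * sin (Im z)| <= `|Im z|.
  rewrite normrM (gtr0_norm e0); have := normr_ge0 (sin (Im z)); nra.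
have := ler_normD (expR (Re z) * (cos (Im z) - 1)) (expR (Re z) - 1).
lra.
Qed.

Lemma Cexp_quad_bound z : N z <= 1 / 2 -> N (Cexp z - 1 - z) <= 4 * N z ^+ 2.
Proof.
move=> zh; apply: le_trans (normc_le_sum _) _; rewrite !ReB !ImB CexpE /= subr0.
rewrite normc_sqr -(real_normK (num_real (Re z))) -(real_normK (num_real (Im z))).
have rh : `|Re z| <= 1 / 2 := le_trans (ler_Re z) zh.
have e1 := expR_lin_bound rh; have e2 := expR_quad_bound rh.
have c2 := abs_cos1_le2 (Im z).
have s1 := abs_sin_le (Im z); have s2 := abs_sinB_le (Im z).
have e3 : expR (Re z) <= 2 by have := ler_norm (expR (Re z) - 1); lra.
have e0 := expR_gt0 (Re z).
have -> : expR (Re z) * cos (Im z) - 1 - Re z =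
  expR (Re z) * (cos (Im z) - 1) + (expR (Re z) - 1 - Re z) by ring.
have -> : expR (Re z) * sin (Im z) - Im z =
  (expR (Re z) - 1) * sin (Im z) + (sin (Im z) - Im z) by ring.
apply: le_trans (lerD (ler_normD _ _) (ler_normD _ _)) _.
rewrite !normrM (gtr0_norm e0).
set a := `|Re z| in rh e1 e2 *; set b := `|Im z| in c2 s1 s2 *.
have a0 : 0 <= a by exact: normr_ge0.
have b0 : 0 <= b by exact: normr_ge0.
have H1 : expR (Re z) * `|cos (Im z) - 1| <= 2 * b ^+ 2 by apply: ler_pM => //; exact: ltW.
have H2 : `|expR (Re z) - 1| * `|sin (Im z)| <= 2 * a * b by apply: ler_pM.
have H3 : 2 * a * b <= a ^+ 2 + b ^+ 2 by have := sqr_ge0 (a - b); rewrite sqrrB; lra.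
have := sqr_ge0 a; have := sqr_ge0 b; lra.
Qed.

(** Factoring out the exponential of larger modulus leaves the exponent x - y in the left
    half-plane. *)
Lemma Cexp_lip x y : Re x <= Re y -> N (Cexp x - Cexp y) <= 3 * expR (Re y) * N (x - y).
Proof.
move=> xy; have -> : Cexp x - Cexp y = Cexp y * (Cexp (x - y) - 1).
  by rewrite CexpB; field; exact: Cexp_neq0.
rewrite Normc.normcM normc_Cexp mulrAC mulrC ler_wpM2r ?expR_ge0//.
by apply: Cexp_sub1_le; rewrite ReB subr_le0.
Qed.

Lemma is_cdif_Cexp z : is_cdif Cexp z (Cexp z).
Proof.
move=> e e0; have n0 : 0 < N (Cexp z) by rewrite normc_gt0 Cexp_neq0.
exists (Num.min (1 / 2) (e / (4 * N (Cexp z)))).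
  by rewrite lt_min divr_gt0//= divr_gt0// mulr_gt0.
move=> x; rewrite lt_min => /andP[h1]; rewrite ltr_pdivlMr ?mulr_gt0// => h2.
have -> : Cexp x - Cexp z - Cexp z * (x - z) = Cexp z * (Cexp (x - z) - 1 - (x - z)).
  by rewrite CexpB; field; exact: Cexp_neq0.
rewrite Normc.normcM.
apply: le_trans (ler_wpM2l (ltW n0) (Cexp_quad_bound (ltW h1))) _.
have := normc_ge0 (x - z); set t := N (x - z) in h2 * => t0.
by rewrite expr2; nra.
Qed.

Lemma llip_Cexp z : llip Cexp z.
Proof.
exists (3 * expR (Re z + 1)); first by rewrite mulr_ge0 ?expR_ge0.
exists 1 => // x y; wlog xy : x y / Re x <= Re y.
  move=> W hx hy; case: (leP (Re x) (Re y)) => [|/ltW] h; first exact: W.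
  by rewrite normc_subC [X in _ * X]normc_subC; exact: W.
move=> _ hy; apply: le_trans (Cexp_lip xy) _.
rewrite ler_wpM2r ?normc_ge0// ler_wpM2l// ler_expR.
by have := le_trans (ler_norm _) (ler_Re (y - z)); rewrite ReB; lra.
Qed.

Lemma Cexp_eq1_Re z : Cexp z = 1 -> Re z = 0.
Proof.
move=> h; have := normc_Cexp z; rewrite h Normc.normc1 => /esym e.
by apply: expR_inj; rewrite expR0.
Qed.

Lemma Cexp_eq1_cos z : Cexp z = 1 -> cos (Im z) = 1.
Proof.
move=> h; have r := Cexp_eq1_Re h; have := congr1 Re h.
by rewrite CexpE r /= expR0 mul1r.
Qed.

Lemma cos_eq1 (a : R) : cos a = 1 -> `|a| < pi *+ 2 -> a = 0.
Proof.
move=> ca; wlog a0 : a ca / 0 <= a.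
  move=> W h; case: (leP 0 a) => [|/ltW] a0; first exact: W.
  by apply: oppr_inj; rewrite oppr0; apply: W; rewrite ?cosN ?oppr_ge0 ?normrN.
rewrite ger0_norm// mulr2n => a2; have := cos_halfE a; rewrite ca subrr => /eqP.
rewrite eq_sym mulf_eq0 pnatr_eq0/= expf_eq0/= => /eqP s0.
apply/eqP; rewrite eq_le a0 andbT leNgt; apply/negP => ap.
have := @sin_gt0_pi R (a / 2); rewrite s0 ltxx => H.
suff : false by []. apply: H; apply/andP; split; lra.
Qed.

Lemma Cexp_eq1 z : Cexp z = 1 -> `|Im z| < pi *+ 2 -> z = 0.
Proof.
move=> h /(cos_eq1 (Cexp_eq1_cos h)) i0.
by apply: complex_ext; rewrite ?i0// (Cexp_eq1_Re h).
Qed.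

(** Along the segment f - g takes values in 2 pi i Z and starts at 0. By the intermediate value
    theorem, if Im (f - g) ended away from 0 it would pass through a nonzero value of modulus at
    most pi, where the exponential cannot be 1. *)
Lemma lift_unique (f g : C -> C) (v w : C) :
  (forall t : R, 0 <= t <= 1 -> ccont f (v + t%:C * (w - v))) ->
  (forall t : R, 0 <= t <= 1 -> ccont g (v + t%:C * (w - v))) ->
  (forall t : R, 0 <= t <= 1 ->
    Cexp (f (v + t%:C * (w - v))) = Cexp (g (v + t%:C * (w - v)))) ->
  f v = g v -> f w = g w.
Proof.
move=> cf cg efg e0; pose p (t : R) := v + t%:C * (w - v).
pose h t := f (p t) - g (p t).
have h1 t : 0 <= t <= 1 -> Cexp (h t) = 1.
  by move=> t01; rewrite /h CexpB efg// divff ?Cexp_neq0.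
have p1 : p 1 = w by rewrite /p rmorph1 mul1r addrC subrK.
have p0 : p 0 = v by rewrite /p rmorph0 mul0r addr0.
have hc (t : R) : 0 <= t <= 1 -> forall e, 0 < e -> exists2 d, 0 < d &
    forall s, `|s - t| < d -> N (h s - h t) < e.
  move=> t01 e ep.
  have e2 : 0 < e / 2 by lra.
  have [d1 d10 k1] := cf t t01 _ e2; have [d2 d20 k2] := cg t t01 _ e2.
  have q0 : 0 < N (w - v) + 1 by rewrite ltr_wpDl ?normc_ge0.
  exists (Num.min d1 d2 / (N (w - v) + 1)); first by rewrite divr_gt0// lt_min d10.
  move=> s; rewrite ltr_pdivlMr// => st.
  have : N (p s - p t) < Num.min d1 d2.
    have -> : p s - p t = (s - t)%:C * (w - v) by rewrite /p rmorphB/=; ring.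
    rewrite Normc.normcM normc_real; apply: le_lt_trans st.
    by rewrite ler_wpM2l// lerDl.
  rewrite lt_min => /andP[/k1 l1 /k2 l2].
  have -> : h s - h t = (f (p s) - f (p t)) - (g (p s) - g (p t)) by rewrite /h; ring.
  by apply: le_lt_trans (normc_sub _ _) _; rewrite /p; lra.
have cI (t : R) : t \in `[0, 1]%R -> {for t, continuous (fun t => Im (h t))}.
  rewrite in_itv/= => t01; apply/cvgrPdist_lt => e ep.
  have [d d0 k] := hc t t01 e ep.
  apply/nbhs_ballP; exists d => //= s; rewrite /ball/= distrC => /k st.
  by rewrite -ImB; apply: le_lt_trans (ler_Im _) _; rewrite normc_subC.
have cW : {within `[0, 1], continuous (fun t => Im (h t))}.
  by apply: continuous_in_subspaceT => t; rewrite inE/=; exact: cI.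
have h00 : h 0 = 0 by rewrite /h p0 e0 subrr.
have l01 : (0 : R) <= (1 : R) <= 1 by rewrite ler01 lexx.
suff I1 : Im (h 1) = 0.
  have r1 := Cexp_eq1_Re (h1 _ l01).
  have : h 1 = 0 by apply: complex_ext; rewrite ?r1 ?I1.
  by rewrite /h p1 => /eqP; rewrite subr_eq0 => /eqP.
have pi0 := pi_gt0 R.
have key v0 : `|v0| <= pi -> (Im (h 1) <= v0 <= 0) || (0 <= v0 <= Im (h 1)) -> v0 = 0.
  move=> vpi vb; have := IVT ler01 cW (v := v0); rewrite h00 /= ge_min le_max.
  have -> : ((0 <= v0) || (Im (h 1) <= v0)) && ((v0 <= 0) || (v0 <= Im (h 1))).
    by case/orP: vb => /andP[-> ->]; rewrite ?orbT.
  move=> /(_ isT) [c]; rewrite in_itv/= => c01 e; rewrite -e; apply: cos_eq1.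
    by apply: Cexp_eq1_cos; exact: h1.
  by rewrite e mulr2n; lra.
have [i0|i0|//] := ltgtP (Im (h 1)) 0.
- have [i1|i1] := leP (- pi) (Im (h 1)).
    by apply: key; [rewrite ler_norml i1/=; lra|rewrite lexx ltW].
  have : - pi = 0 :> R.
    by apply: key; [rewrite normrN gtr0_norm|rewrite (ltW i1)/= oppr_le0 ltW].
  lra.
- have [i1|i1] := leP (Im (h 1)) pi.
    by apply: key; [rewrite ler_norml i1 andbT; lra|apply/orP; right; rewrite lexx ltW].
  have : pi = 0 :> R.
    by apply: key; [rewrite gtr0_norm|apply/orP; right; rewrite !ltW].
  lra.
Qed.

End ComplexExp.

(** * Logarithms *)
Section Logarithm.
Variable R : realType.
Local Notation C := R[i].
Local Notation N := (@Normc.normc R).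
Local Notation Re := (@complex.Re R).
Local Notation Im := (@complex.Im R).
Implicit Types (x y z w v : C).

(* Principal logarithm; meaningful only on the half-plane [Re z > 0]. *)
Definition Log (z : C) : C := ln (N z) +i* atan (Im z / Re z).

Lemma Cexp_Log z : 0 < Re z -> Cexp (Log z) = z.
Proof.
move=> rz; have z0 : 0 < N z by apply: lt_le_trans rz (le_trans (ler_norm _) (ler_Re z)).
set t := Im z / Re z.
have c0 : cos (atan t) != 0 by rewrite gt_eqF// cos_gt0_pihalf// atan_gtNpi2 atan_ltpi2.
have st : sin (atan t) = t * cos (atan t).
  by have := atanK t; rewrite /tan => {2}<-; rewrite divfK.
have Nc : N z * cos (atan t) = Re z.
  rewrite cos_atan; have -> : 1 + t ^+ 2 = (N z / Re z) ^+ 2.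
    by rewrite [RHS]expr_div_n normc_sqr /t; field; rewrite gt_eqF.
  rewrite sqrtr_sqr ger0_norm; last by rewrite divr_ge0 ?normc_ge0 ?ltW.
  by field; rewrite !gt_eqF.
rewrite CexpE /= lnK ?posrE// st mulrCA Nc [RHS]complex_eta.
by congr (_ +i* _); rewrite /t divfK// gt_eqF.
Qed.

Lemma ImLog_bound z : `|Im (Log z)| < pi / 2.
Proof. by rewrite ltr_norml atan_gtNpi2 atan_ltpi2. Qed.

Lemma Log1 : Log 1 = 0.
Proof. by rewrite /Log Normc.normc1 ln1 /= mul0r atan0. Qed.

Lemma Log_real_Im (a : R) : Im (Log a%:C) = 0.
Proof. by rewrite /Log /= mul0r atan0. Qed.

Lemma Re_near1 v : N v <= 1 / 2 -> 0 < Re (1 + v).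
Proof. by move=> h; rewrite ReD /=; have := le_trans (ler_Re v) h; rewrite ler_norml; lra. Qed.

Lemma ln_le_sub1 (a : R) : 0 < a -> ln a <= a - 1.
Proof.
move=> a0; have -> : ln a = ln (1 + (a - 1)) by congr ln; ring.
by apply: le_ln1Dx; lra.
Qed.

Lemma Log1D_le v : N v <= 1 / 2 -> N (Log (1 + v)) <= 4 * N v.
Proof.
move=> h; apply: le_trans (normc_le_sum _) _.
have v0 := normc_ge0 v.
have l1 : 1 - N v <= N (1 + v).
  by have := normc_subl 1 (- v); rewrite normc_opp opprK Normc.normc1.
have l2 : N (1 + v) <= 1 + N v by have := normc_add 1 v; rewrite Normc.normc1.
have r0 := Re_near1 h.
have H1 : `|ln (N (1 + v))| <= 2 * N v.
  have p0 : 0 < N (1 + v) by lra.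
  have b1 : ln (N (1 + v)) <= N v.
    by have := ln_le_sub1 p0; lra.
  have b2 : - ln (N (1 + v)) <= 2 * N v.
    have i0 : 0 < (N (1 + v))^-1 by rewrite invr_gt0.
    rewrite -lnV ?posrE//; apply: le_trans (ln_le_sub1 i0) _.
    rewrite lerBlDr -(@ler_pM2r _ (N (1 + v)))// mulVf ?gt_eqF//; nra.
  by rewrite ler_norml; lra.
have H2 : `|atan (Im (1 + v) / Re (1 + v))| <= 2 * N v.
  apply: le_trans (abs_atan_le _) _; rewrite normrM normfV (gtr0_norm r0) ler_pdivrMr//.
  have := ler_Im v; have : 1 / 2 <= Re (1 + v).
    by rewrite ReD /=; have := le_trans (ler_Re v) h; rewrite ler_norml; lra.
  by rewrite ImD /= add0r; nra.
by rewrite /Log /=; lra.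
Qed.

(** Both sides have the same exponential, and three arguments below pi / 2 combine to less than 2
    pi. *)
Lemma Log_quot x y : 0 < Re x -> 0 < Re y -> 0 < Re (x / y) ->
  Log x - Log y = Log (x / y).
Proof.
move=> x0 y0 q0; apply/eqP; rewrite -subr_eq0; apply/eqP; apply: Cexp_eq1.
  have yn : y != 0 by apply: contraTneq y0 => ->; rewrite ltxx.
  have xn : x != 0 by apply: contraTneq x0 => ->; rewrite ltxx.
  by rewrite !CexpB !Cexp_Log//; field; rewrite xn yn.
have := ImLog_bound x; have := ImLog_bound y; have := ImLog_bound (x / y).
have p0 := pi_gt0 R.
rewrite !ImB [pi *+ 2]mulr2n => a b c; apply: le_lt_trans (ler_normB _ _) _.
by have := ler_normB (Im (Log x)) (Im (Log y)); lra.
Qed.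

(** Here |y| is at least 7/8 Re z and |x - y| at most Re z / 4, which puts x / y in the disc of
    radius 1/2 about 1, where the estimates for [Log] hold. *)
Lemma quot_near z x y : 0 < Re z -> N (x - z) < Re z / 8 -> N (y - z) < Re z / 8 ->
  [/\ 0 < Re x, 0 < Re y & N (x / y - 1) <= 2 / Re z * N (x - y)]
  /\ N (x / y - 1) <= 1 / 2.
Proof.
move=> z0 hx hy.
have rx : Re z / 8 * 7 <= Re x.
  by have := le_trans (ler_norm _) (ler_Re (z - x)); rewrite ReB normc_subC; lra.
have ry : Re z / 8 * 7 <= Re y.
  by have := le_trans (ler_norm _) (ler_Re (z - y)); rewrite ReB normc_subC; lra.
have ny : Re z / 8 * 7 <= N y by apply: le_trans ry (le_trans (ler_norm _) (ler_Re y)).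
have yn : y != 0 by rewrite -normc_gt0; lra.
have e : N (x / y - 1) = N (x - y) / N y.
  by rewrite -Normc.normcV -Normc.normcM; congr N; field.
have d0 := normc_ge0 (x - y).
have dd : N (x - y) <= Re z / 4.
  by have := normc_dist x z y; rewrite [N (z - y)]normc_subC; lra.
rewrite e; split; last by rewrite ler_pdivrMr; lra.
split; [lra|lra|].
rewrite ler_pdivrMr; last lra.
rewrite mulrAC mulrC -[X in X <= _]mulr1 ler_wpM2l//.
rewrite mulrAC ler_pdivlMr//; lra.
Qed.

Lemma Log_lip z x y : 0 < Re z -> N (x - z) < Re z / 8 -> N (y - z) < Re z / 8 ->
  N (Log x - Log y) <= 8 / Re z * N (x - y).
Proof.
move=> z0 hx hy; have [[rx ry q1] q2] := quot_near z0 hx hy.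
have e : x / y = 1 + (x / y - 1) by ring.
rewrite Log_quot//; last by rewrite e; exact: Re_near1.
rewrite e; apply: le_trans (Log1D_le q2) _; lra.
Qed.

Lemma llip_Log z : 0 < Re z -> llip Log z.
Proof.
move=> z0; exists (8 / Re z); first by rewrite divr_ge0// ltW.
by exists (Re z / 8); [rewrite divr_gt0|move=> x y; exact: Log_lip].
Qed.

Lemma is_cdif_Log1 : is_cdif Log 1 1.
Proof.
(* With l = Log (1 + v), |l| <= 4 |v|, so the remainder 4 |l|^2 of the exponential is at most 64
   |v|^2; the radius 1/8 keeps |l| <= 1/2. *)
move=> e e0; exists (Num.min (1 / 8) (e / 64)).
  by rewrite lt_min !divr_gt0.
move=> x; rewrite lt_min => /andP[h1 h2]; rewrite mul1r Log1 subr0.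
set v := x - 1 in h1 h2 *; have xv : x = 1 + v by rewrite /v; ring.
have v0 := normc_ge0 v.
have vh : N v <= 1 / 2 by lra.
have lv := Log1D_le vh.
have := @Cexp_quad_bound R (Log (1 + v)); rewrite Cexp_Log ?Re_near1//.
have -> : 1 + v - 1 - Log (1 + v) = - (Log (1 + v) - v) by ring.
rewrite normc_opp -xv in lv *; rewrite xv in lv *.
move=> /(_ _)/le_trans; apply; first lra.
have := normc_ge0 (Log (1 + v)); nra.
Qed.

Lemma cdif_Log z : 0 < Re z -> cdif Log z.
Proof.
move=> z0; have zn : z != 0 by apply: contraTneq z0 => ->; rewrite ltxx.
apply: (@cdif_eq _ _ (fun x => Log z + Log (x / z)) z (Re z / 8)).
- by rewrite divr_gt0.
- move=> x hx; have hz : N (z - z) < Re z / 8.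
    by rewrite subrr Normc.normc0 divr_gt0.
  have [[rx _ _] q2] := quot_near z0 hx hz.
  rewrite -Log_quot//; first by ring.
  by rewrite (_ : x / z = 1 + (x / z - 1)) ?Re_near1//; ring.
- apply: cdifD (cdif_cst _ _) _; apply: (cdif_comp (g := fun x => x / z)).
    by apply: cdifM (cdif_id _) (cdif_cst _ _).
  by rewrite divff//; exists 1; exact: is_cdif_Log1.
Qed.

Lemma ccont_Log z : 0 < Re z -> ccont Log z.
Proof. by move=> z0; exact: llip_cont (llip_Log z0). Qed.

Lemma Arg_Cexp w : `|Im w| < pi -> Arg (Cexp w) = Im w.
Proof.
rewrite ltr_norml => /andP[w1 w2]; rewrite /Arg.
rewrite ifF; last by apply/negbTE; exact: Cexp_neq0.
rewrite /cabs -/(@Normc.normc R) normc_Cexp CexpE /=.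
have e0 := expR_gt0 (Re w).
rewrite pmulr_rge0// [_ / _]mulrAC divff ?gt_eqF// mul1r.
have [i0|i0] := leP 0 (Im w).
  rewrite ifT; last by apply: sin_ge0_pi; rewrite i0 ltW.
  by apply: cosK; rewrite in_itv/= i0 ltW.
rewrite ifF; last first.
  apply/negbTE; rewrite -ltNge -oppr_gt0 -sinN; apply: sin_gt0_pi.
  by apply/andP; split; lra.
by rewrite cosKN ?opprK// (ltW w1) ltW.
Qed.

Lemma ReN_ratio z : z != 0 -> -1 <= Re z / N z <= 1.
Proof.
rewrite -normc_gt0 => z0; rewrite -ler_norml normrM normfV (gtr0_norm z0).
by rewrite ler_pdivrMr// mul1r ler_Re.
Qed.

Lemma Arg_le_pi z : `|Arg z| <= pi.
Proof.
rewrite /Arg; case: eqVneq => [_|z0]; first by rewrite normr0 pi_ge0.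
have r := ReN_ratio z0.
by case: ifP => _; rewrite ?normrN ger0_norm ?acos_ge0 ?acos_lepi.
Qed.

Lemma Cexp_clog z : z != 0 -> Cexp (clog z) = z.
Proof.
move=> z0; have n0 : 0 < N z by rewrite normc_gt0.
have r := ReN_ratio z0.
rewrite CexpE /clog /= lnK ?posrE//.
have ca : cos (Arg z) = Re z / N z.
  by rewrite /Arg (negbTE z0); case: ifP => _; rewrite ?cosN acosK.
have s2 : Num.sqrt (1 - (Re z / N z) ^+ 2) = `|Im z| / N z.
  have -> : 1 - (Re z / N z) ^+ 2 = (Im z / N z) ^+ 2.
    rewrite !expr_div_n -{1}(@divff _ (N z ^+ 2)) ?expf_neq0 ?gt_eqF//.
    by rewrite -mulrBl normc_sqr addrAC subrr add0r.
  by rewrite sqrtr_sqr normrM normfV (gtr0_norm n0).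
have sa : sin (Arg z) = Im z / N z.
  rewrite /Arg (negbTE z0); case: ifP => i0; rewrite ?sinN sin_acos// s2.
    by rewrite ger0_norm.
  by rewrite ltr0_norm ?mulNr ?opprK// ltNge i0.
change (cabs z) with (N z).
rewrite ca sa; apply: complex_ext => /=; field; by rewrite gt_eqF.
Qed.

End Logarithm.

(** * Continuous logarithms on star-shaped domains *)

Section LogBranch.
Variable R : realType.
Local Notation C := R[i].
Local Notation N := (@Normc.normc R).
Local Notation Re := (@complex.Re R).
Local Notation Im := (@complex.Im R).

(** Compactness of [a, b]; monotonicity in n merges the finitely many local indices into one. *)
Lemma segment_uniform (P : nat -> R -> Prop) (a b : R) :
  (forall n m t, (n <= m)%N -> P n t -> P m t) ->
  (forall t, a <= t <= b -> exists n, exists2 d : R, 0 < d &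
     forall s, `|s - t| < d -> P n s) ->
  exists n, forall t, a <= t <= b -> P n t.
Proof.
move=> mono loc.
have K := @segment_compact R a b; move/compact_near_coveringP: K.
move=> /(_ nat \oo (fun n t => P n t) _)[].
  move=> t; rewrite /= in_itv/= => /loc[n [d d0 h]].
  exists (ball t d, [set m | (n <= m)%N]) => /=.
    by split; [exact: nbhsx_ballx|exists n].
  move=> [s m] /= [ts nm]; apply: mono nm _; apply: h.
  by rewrite distrC.
move=> n _ h; exists n => t tab; apply: (h n) => //=.
Qed.

(* Continuity of [L] together with the exponential equation already gives the
   regularity of [L]: near [w], [L = L w + Log (H / H w)]. *)
Lemma log_branch_local (L H : C -> C) (w : C) (d : R) : 0 < d ->
  (forall x, N (x - w) < d -> Cexp (L x) = H x) ->
  ccont L w -> ccont H w ->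
  exists2 d' : R, 0 < d' & forall x, N (x - w) < d' -> L x = L w + Log (H x / H w).
Proof.
move=> d0 eL cL cH.
have hw0 : H w != 0 by rewrite -eL ?Cexp_neq0// subrr Normc.normc0.
have nw : 0 < N (H w) by rewrite normc_gt0.
(* Distance 1 is close enough: together with an argument below pi / 2 it stays under 2 pi, as pi >=
   2. *)
have [d1 d10 h1] := cL 1 ltr01.
have e2 : 0 < N (H w) / 2 by rewrite divr_gt0.
have [d2 d20 h2] := cH _ e2.
exists (Num.min d (Num.min d1 d2)); first by rewrite !lt_min d0 d10.
move=> x; rewrite !lt_min => /and3P[xd /h1 x1 /h2 x2].
apply/eqP; rewrite -subr_eq0; apply/eqP; apply: Cexp_eq1.
  have q : 0 < Re (H x / H w).
    rewrite (_ : H x / H w = 1 + (H x - H w) / H w); last by field.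
    apply: Re_near1; rewrite Normc.normcM Normc.normcV ler_pdivrMr//; lra.
  have hx0 : H x != 0 by rewrite -eL ?Cexp_neq0.
  rewrite CexpB CexpD Cexp_Log// !eL ?subrr ?Normc.normc0//.
  by field; rewrite hx0 hw0.
have := ImLog_bound (H x / H w); have p2 := @pi_ge2 R.
have := ler_Im (L x - L w) => a b; rewrite opprD addrA ImB.
apply: le_lt_trans (ler_normB _ _) _.
rewrite [pi *+ 2]mulr2n; lra.
Qed.

Lemma inv_nat_small (e : R) : 0 < e -> exists n : nat, n.+1%:R^-1 < e.
Proof.
move=> e0; exists (Num.bound e^-1).
rewrite -[ltRHS]invrK ltf_pV2 ?posrE ?invr_gt0//.
apply: lt_trans (archi_boundP _) _; first by rewrite invr_ge0 ltW.
by rewrite ltr_nat.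
Qed.

Lemma inv_natS_le (n m : nat) : (n <= m)%N -> (m.+1%:R^-1 : R) <= n.+1%:R^-1.
Proof. by move=> nm; rewrite lef_pV2 ?posrE// ler_nat. Qed.

Section Lift.
Variables (S : C -> Prop) (H : C -> C) (l0 : C).
Hypothesis S_open : forall w, S w -> exists2 d : R, 0 < d & forall x, N (x - w) < d -> S x.
Hypothesis S_star : forall w (t : R), S w -> 0 <= t <= 1 -> S (t%:C * w).
Hypothesis H_cont : forall w, S w -> ccont H w.
Hypothesis H_neq0 : forall w, S w -> H w != 0.
Hypothesis Hl0 : Cexp l0 = H 0.

Let node (n k : nat) : R := k%:R / n.+1%:R.

(* The logarithm accumulated along [n.+1] equal steps of the segment from 0 to w. *)
Let T (n : nat) (w : C) := l0 +
  \sum_(k < n.+1) Log (H ((node n k.+1)%:C * w) / H ((node n k)%:C * w)).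

(** Guarantees that each quotient in [T] lies in the half-plane where [Log] inverts the exponential.
    It ranges over all close parameters, not just the nodes, so that it is inherited by the points t
    w of the segment. *)
Let good (n : nat) (w : C) := forall s t : R, 0 <= s <= 1 -> 0 <= t <= 1 ->
  `|s - t| <= n.+1%:R^-1 -> N (H (s%:C * w) / H (t%:C * w) - 1) <= 1 / 2.

Let node01 n k : (k <= n.+1)%N -> 0 <= node n k <= 1.
Proof.
by move=> kn; rewrite /node divr_ge0//= ler_pdivrMr// mul1r ler_nat.
Qed.

Let node_step n k : `|node n k.+1 - node n k| <= n.+1%:R^-1.
Proof.
by rewrite /node -mulrBl -natrB// subSn// subnn mul1r ger0_norm// invr_ge0.
Qed.

(** Continuity of the lift at w compares values of [T] for one n at all nearby points, so n must
    serve a whole neighbourhood. Nearby points w' are therefore part of the property to which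
    compactness of [0, 1] is applied. *)
Lemma good_near w : S w -> exists n, forall m w', (n <= m)%N ->
  N (w' - w) < n.+1%:R^-1 -> S w' /\ good m w'.
Proof.
move=> Sw; have [dS dS0 hS] := S_open Sw.
pose P (n : nat) (t : R) := forall m w', (n <= m)%N -> N (w' - w) < n.+1%:R^-1 ->
  S w' /\ forall s : R, 0 <= s <= 1 -> `|s - t| <= m.+1%:R^-1 ->
    N (H (s%:C * w') / H (t%:C * w') - 1) <= 1 / 2.
have mono n m t : (n <= m)%N -> P n t -> P m t.
  move=> nm h k w' mk hw'; apply: h (leq_trans nm mk) _.
  exact: lt_le_trans hw' (inv_natS_le nm).
have [n hn] : exists n, forall t : R, 0 <= t <= 1 -> P n t.
  apply: segment_uniform mono _ => t t01.
  have Stw := S_star Sw t01; have h0 : 0 < N (H (t%:C * w)).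
    by rewrite normc_gt0 H_neq0.
  have e0 : 0 < N (H (t%:C * w)) / 8 by rewrite divr_gt0.
  have [d d0 hd] := H_cont Stw e0.
  have q0 : 0 < 2 * N w + 4 by have := normc_ge0 w; lra.
  (* If |s - t| <= 2 eta and |w' - w| < eta, then s w' is within eta (2 |w| + 3) of t w, hence
     closer than d. *)
  pose eta := Num.min 1 (Num.min dS (d / (2 * N w + 4))).
  have eta0 : 0 < eta by rewrite !lt_min ltr01 dS0 divr_gt0.
  have eta1 : eta <= 1 by rewrite ge_min lexx.
  have etaS : eta <= dS by rewrite /eta !ge_min lexx orbT.
  have etad : eta * (2 * N w + 4) <= d.
    by rewrite -ler_pdivlMr// /eta !ge_min lexx !orbT.
  have [n hn] := inv_nat_small eta0.
  exists n; exists eta => // t' tt m w' nm hw'.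
  have hw : N (w' - w) < eta by exact: lt_trans hn.
  split; first by apply: hS; exact: lt_le_trans etaS.
  have near (s : R) : `|s - t| <= 2 * eta -> N (s%:C * w' - t%:C * w) < d.
    move=> st; apply: lt_le_trans etad.
    have -> : s%:C * w' - t%:C * w = (s - t)%:C * w' + t%:C * (w' - w).
      by rewrite rmorphB /=; ring.
    apply: le_lt_trans (normc_add _ _) _; rewrite !Normc.normcM !normc_real.
    have nw' : N w' <= N w + 1 by have := normc_subl w' w; lra.
    have tn : `|t| <= 1 by case/andP: t01 => a b; rewrite ger0_norm.
    have := normc_ge0 w; have := normc_ge0 (w' - w); have := normc_ge0 w'.
    have := normr_ge0 (s - t); have := normr_ge0 t; nra.
  move=> s s01 st'.
  have sm : `|s - t'| <= eta.
    by apply: le_trans st' (le_trans (inv_natS_le nm) (ltW hn)).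
  have H1 : N (H (s%:C * w') - H (t%:C * w)) < N (H (t%:C * w)) / 8.
    by apply: hd; apply: near; have := ler_distD t' s t; lra.
  have H2 : N (H (t'%:C * w') - H (t%:C * w)) < N (H (t%:C * w)) / 8.
    by apply: hd; apply: near; lra.
  set A := H (s%:C * w') in H1 *; set B := H (t'%:C * w') in H2 *.
  set Z := H (t%:C * w) in h0 H1 H2 *.
  have nB : N Z * (7 / 8) <= N B.
    by have := normc_subl Z B; rewrite normc_subC; lra.
  have Bn : B != 0 by rewrite -normc_gt0; lra.
  rewrite (_ : A / B - 1 = (A - B) / B); last by field.
  rewrite Normc.normcM Normc.normcV ler_pdivrMr ?normc_gt0//.
  by have := normc_dist A Z B; rewrite [N (Z - B)]normc_subC; lra.
exists n => m w' nm hw'; split.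
  by have [] := hn 0 _ m w' nm hw'; rewrite ?lexx ?ler01.
by move=> s t s01 t01 st; have [_] := hn t t01 m w' nm hw'; exact.
Qed.

Let good_Re n w k : good n w -> (k < n.+1)%N ->
  0 < Re (H ((node n k.+1)%:C * w) / H ((node n k)%:C * w)).
Proof.
move=> g kn; set q := _ / _; rewrite (_ : q = 1 + (q - 1)); last by ring.
by apply/Re_near1/g; [exact: node01|exact/node01/ltnW|exact: node_step].
Qed.

Let T_exp n w : S w -> good n w -> Cexp (T n w) = H w.
Proof.
move=> Sw g; rewrite /T CexpD Hl0 (Cexp_sum _
  (fun k => Log (H ((node n k.+1)%:C * w) / H ((node n k)%:C * w)))).
have -> : H 0 = H ((node n 0)%:C * w) by rewrite /node mul0r rmorph0 mul0r.
have part j : (j <= n.+1)%N -> H ((node n 0)%:C * w) *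
    \prod_(k < j) Cexp (Log (H ((node n k.+1)%:C * w) / H ((node n k)%:C * w))) =
    H ((node n j)%:C * w).
  elim: j => [|j IH] jn; first by rewrite big_ord0 mulr1.
  rewrite big_ord_recr /= mulrA IH 1?ltnW// Cexp_Log; last exact: good_Re.
  by rewrite mulrC divfK//; apply: H_neq0; apply: S_star => //; exact/node01/ltnW.
by rewrite part// /node divff// rmorph1 mul1r.
Qed.

Let T_cont n w : S w -> good n w -> ccont (T n) w.
Proof.
move=> Sw g; apply: ccontD (ccont_cst _ _) _.
apply: (ccont_sum (f := fun k x => Log (H ((node n k.+1)%:C * x) / H ((node n k)%:C * x)))).
move=> k kn; apply: (ccont_comp (g := fun x => H ((node n k.+1)%:C * x) / H ((node n k)%:C * x))).
  have c j : (j <= n.+1)%N -> ccont (fun x => H ((node n j)%:C * x)) w.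
    move=> jn; apply: (ccont_comp (g := fun x => (node n j)%:C * x)).
      by apply: ccontM (ccont_cst _ _) (@ccont_id _ _).
    by apply: H_cont; apply: S_star => //; exact: node01.
  apply: ccontM (c _ kn) _; apply: ccontV (c _ (ltnW kn)).
  by apply: H_neq0; apply: S_star => //; exact/node01/ltnW.
by apply: ccont_Log; exact: good_Re.
Qed.

Let T0 n : H 0 != 0 -> T n 0 = l0.
Proof.
by move=> h; rewrite /T big1 ?addr0// => k _; rewrite !mulr0 divff// Log1.
Qed.

Let good_scale n w (t : R) : 0 <= t <= 1 -> good n w -> good n (t%:C * w).
Proof.
move=> /andP[t0 t1] g s u /andP[s0 s1] /andP[u0 u1] su.
rewrite !mulrA -!rmorphM /=; apply: g.
- by rewrite mulr_ge0//= mulr_ile1.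
- by rewrite mulr_ge0//= mulr_ile1.
- by rewrite -mulrBl normrM; apply: le_trans su; rewrite ler_piMr// ger0_norm.
Qed.

(** Both subdivisions give continuous lifts of [H] along the segment from 0 to w, with the same
    start [l0]. *)
Let T_indep n m w : S w -> good n w -> good m w -> T n w = T m w.
Proof.
move=> Sw gn gm.
have S0 : S 0 by have := S_star Sw (t := 0); rewrite rmorph0 mul0r; apply; rewrite lexx ler01.
apply: (@lift_unique _ _ _ 0).
- by move=> t t01; rewrite add0r subr0; apply: T_cont; [exact: S_star|exact: good_scale].
- by move=> t t01; rewrite add0r subr0; apply: T_cont; [exact: S_star|exact: good_scale].
- move=> t t01; rewrite add0r subr0 !T_exp//.
  + exact: S_star.
  + exact: good_scale.
  + exact: S_star.
  + exact: good_scale.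
- by rewrite !T0 ?H_neq0.
Qed.

Lemma log_branch_exists : S 0 -> exists L : C -> C,
  L 0 = l0 /\ forall w, S w -> ccont L w /\ Cexp (L w) = H w.
Proof.
move=> S0.
have /choice[n hn] : forall w, exists n, S w -> forall m w', (n <= m)%N ->
    N (w' - w) < n.+1%:R^-1 -> S w' /\ good m w'.
  move=> w; have [Sw|nSw] := pselect (S w); last by exists 0%N.
  by have [n hn] := good_near Sw; exists n.
have gself w m : S w -> (n w <= m)%N -> good m w.
  move=> Sw nm; have [] := hn w Sw m w nm _ => //.
  by rewrite subrr Normc.normc0 invr_gt0.
exists (fun w => T (n w) w); split; first by rewrite T0 ?H_neq0.
move=> w Sw; split; last by apply: T_exp => //; exact: gself.
have r0 : (0 : R) < (n w).+1%:R^-1 by rewrite invr_gt0.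
(* The index chosen varies with the point, but near w it may be frozen at [n w] by [T_indep]. *)
apply: (ccont_eq r0 (g := T (n w))); last by apply: T_cont => //; exact: gself.
move=> x hx; have [Sx gx] := hn w Sw _ x (leqnn _) hx.
by apply: T_indep => //; exact: gself.
Qed.

End Lift.
End LogBranch.

(** * Topology and escaping orbits *)
Section TopologyBridge.
Variable R : realType.
Local Notation C := R[i].
Local Notation N := (@Normc.normc R).

Lemma normE (z : C) : `|z| = (N z)%:C.
Proof. by rewrite normc_def normc_sqrt. Qed.

Lemma nbhs_CC (z : CC R) (P : set (CC R)) :
  nbhs z P <-> exists2 d : R, 0 < d & forall x : C, N (x - z) < d -> P x.
Proof.
split=> [/nbhs_ballP[e /= e0 h]|[d d0 h]].
  (* Balls in [CC] have radii in [R[i]]; positivity in that order forces the radius to be real. *)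
  have ie : complex.Im e = 0 by apply: ger0_Im; exact: ltW.
  move: e0 h; rewrite (Im0_real ie) => e0 h.
  exists (complex.Re e); first by rewrite -ltcR.
  by move=> x xz; apply: h; rewrite -ball_normE /ball_ /= normE ltcR normc_subC.
apply/nbhs_ballP; exists d%:C => /=; first by rewrite ltcR.
by move=> x; rewrite -ball_normE /ball_ /= normE ltcR normc_subC => /h.
Qed.

Lemma is_cdif_derivable (f : CC R -> CC R) (z l : CC R) :
  is_cdif f z l -> derivable f z 1.
Proof.
move=> h; apply: (cvgP l) => P /nbhs_CC[e e0 hP].
have e2 : 0 < e / 2 by rewrite divr_gt0.
have [d d0 hd] := h _ e2.
apply/nbhs_CC; exists d => // x; rewrite subr0 => xd x0.
apply: hP; have nx : 0 < N x by rewrite normc_gt0.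
change (N (x^-1 * (f ((x : C) * 1 + z : C) - f z : C) - l : C) < e); rewrite mulr1.
have := hd (x + z : C); rewrite addrK => /(_ xd) k.
have -> : x^-1 * (f (x + z : C) - f z : C) - l = x^-1 * (f (x + z : C) - f z - l * x : C).
  by field.
rewrite Normc.normcM Normc.normcV mulrC ltr_pdivrMr//.
by apply: le_lt_trans k _; rewrite ltr_pM2r//; lra.
Qed.

Lemma is_derive_cdif (f : CC R -> CC R) (z l : CC R) :
  is_derive z 1 f l -> is_cdif f z l.
Proof.
move=> [df fl] e e0.
have H : nbhs ('D_1 f z) [set y : CC R | N ((y : C) - (l : C)) < e].
  by rewrite fl; apply/nbhs_CC; exists e.
have /nbhs_CC[d d0 hd] := df _ H.
exists d => // x xz; have [->|xz0] := eqVneq x z.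
  by rewrite !subrr mulr0 subr0 Normc.normc0 mulr0.
have hn0 : x - z != 0 by rewrite subr_eq0.
have := hd (x - z); rewrite subr0 => /(_ xz hn0).
change (N ((x - z)^-1 * (f ((x - z : C) * 1 + z : C) - f z : C) - l : C) < e -> 
  N (f x - f z - l * (x - z) : C) <= e * N (x - z)).
rewrite mulr1 subrK => h.
have -> : (f x - f z - l * (x - z) : C) = ((x - z)^-1 * (f x - f z : C) - l) * (x - z).
  by field.
by rewrite Normc.normcM ler_wpM2r ?normc_ge0// ltW.
Qed.

Lemma derivable_cdif (f : CC R -> CC R) (z : CC R) : derivable f z 1 -> cdif f z.
Proof. by move=> /derivableP h; eexists; exact: is_derive_cdif h. Qed.

Lemma cdif_derivable (f : CC R -> CC R) (z : CC R) : cdif f z -> derivable f z 1.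
Proof. by move=> [l h]; exact: is_cdif_derivable h. Qed.

End TopologyBridge.

(** * Growth of the polynomial near infinity and escaping orbits *)

Section Escape.
Variable R : realType.
Local Notation C := R[i].
Local Notation N := (@Normc.normc R).
Variables (q : {poly C}) (d : nat).
Hypothesis d2 : (2 <= d)%N.
Hypothesis size_q : size q = d.+1.
Let a := lead_coef q.

Lemma lead_neq0 : lead_coef q != 0.
Proof. by rewrite lead_coef_eq0 -size_poly_eq0 size_q. Qed.

Definition revpoly : {poly C} := \poly_(j < d.+1) (q`_(d - j) / a).

Lemma revpoly0 : revpoly.[0] = 1.
Proof.
rewrite horner_coef0 coef_poly /= subn0 /a /lead_coef size_q /= divff//.
by have := lead_neq0; rewrite /lead_coef size_q.
Qed.

Lemma revpolyE (x : C) : x != 0 -> q.[x] = a * x ^+ d * revpoly.[x^-1].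
Proof.
move=> x0; rewrite horner_poly horner_coef size_q mulr_sumr.
rewrite (reindex_inj rev_ord_inj) /=; apply: eq_bigr => j _.
have jd : (j <= d)%N by rewrite -ltnS.
have xd : x ^+ d = x ^+ (d - j) * x ^+ j by rewrite -exprD subnK.
rewrite subSS xd exprVn.
have a0 : a != 0 := lead_neq0.
field; by rewrite a0 expf_neq0.
Qed.

Lemma revpoly_near1 : exists2 K : R, 0 < K & forall x y : C, N x <= 1 -> N y <= 1 ->
  N (revpoly.[x] - revpoly.[y]) <= K * N (x - y) /\ N (revpoly.[x] - 1) <= K * N x.
Proof.
have [K K0 h] := poly_ball_lip revpoly 1; exists (K + 1); first by rewrite ltr_wpDl.
move=> x y x1 y1; split.
  by apply: le_trans (h _ _ x1 y1) _; rewrite ler_wpM2r ?normc_ge0 ?lerDl.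
rewrite -revpoly0; apply: le_trans (h _ _ x1 _) _; first by rewrite Normc.normc0.
by rewrite subr0 ler_wpM2r ?normc_ge0 ?lerDl.
Qed.

(** For |x| > 2 K the factor Q(1/x) has modulus at least 1/2, so |q(x)| >= |a| |x|^2 / 2, using d >=
    2. The factor A is arbitrary: A = 2 describes escape, A = exp M yields decay faster than any
    power. *)
Lemma poly_growth (A : R) : exists2 r : R, 1 <= r & forall x, r < N x -> A * N x <= N q.[x].
Proof.
have [K K0 hK] := revpoly_near1.
have a0 : 0 < N a by rewrite normc_gt0 lead_neq0.
exists (Num.max 1 (Num.max (2 * K) (2 * `|A| / N a))).
  by rewrite le_max lexx.
move=> x; rewrite !gt_max => /and3P[x1 x2 x3].
have x0 : x != 0 by rewrite -normc_gt0; lra.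
have nx0 : 0 < N x by lra.
rewrite revpolyE// !Normc.normcM normc_exp.
have i1 : N x^-1 <= 1 by rewrite Normc.normcV invf_le1// ltW.
have z1 : N (0 : C) <= 1 by rewrite Normc.normc0.
have {z1}[_ h] := hK _ _ i1 z1.
have {}h : N (revpoly.[x^-1] - 1) <= 1 / 2.
  apply: le_trans h _.
  by rewrite Normc.normcV ler_pdivrMr//; lra.
have h2 : 1 / 2 <= N revpoly.[x^-1].
  by have := normc_subl 1 (revpoly.[x^-1]); rewrite Normc.normc1 normc_subC; lra.
have e : N x ^+ 2 <= N x ^+ d by rewrite ler_weXn2l// ltW.
have x3' : 2 * `|A| < N a * N x by rewrite [ltRHS]mulrC -ltr_pdivrMr.
have := ler_norm A => Al.
apply: (@le_trans _ _ (N a * N x ^+ 2 * (1 / 2))).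
  by rewrite expr2; nra.
by apply: ler_pM => //; [rewrite mulr_ge0 ?exprn_ge0// ltW|rewrite ler_pM2l].
Qed.

Local Notation it n z := (iterp q n z).

Lemma iterpS n z : it n.+1 z = q.[it n z].
Proof. by []. Qed.

Lemma iterpD m n z : it (m + n) z = it m (it n z).
Proof. by rewrite /iterp iterD. Qed.

Lemma ccont_iterp n z : ccont (iterp q n) z.
Proof.
elim: n => [|n IH]; first exact: ccont_id.
by apply: (ccont_comp (f := horner q)) => //; exact: cdif_cont (cdif_poly _ _).
Qed.

(** For a radius satisfying [grow] below, a single visit outside the disc forces the orbit to
    infinity, which makes this condition open. *)
Definition escapes (r : R) (z : C) := exists n, r < N (it n z).

Section Radius.
Variable r : R.
Hypothesis r1 : 1 <= r.
Hypothesis grow : forall x, r < N x -> 2 * N x <= N q.[x].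

Lemma iterp_grow z n : r < N z -> 2 ^+ n * N z <= N (it n z).
Proof.
move=> rz; elim: n => [|n IH]; first by rewrite expr0 mul1r.
have p1 : (1 : R) <= 2 ^+ n by rewrite exprn_ege1// ler1n.
rewrite iterpS exprS -mulrA; apply: le_trans (grow _); first by rewrite ler_pM2l.
by apply: lt_le_trans rz (le_trans _ IH); rewrite ler_peMl ?normc_ge0.
Qed.

Lemma escapes_bound z (B : R) : escapes r z ->
  exists n, forall m, (n <= m)%N -> B < N (it m z).
Proof.
move=> [n hn]; have [k hk] := exp2_small `|B| ltr01.
exists (k + n)%N => m km; have [j ->] : exists j, m = (j + k + n)%N.
  by exists (m - (k + n))%N; rewrite -addnA subnK.
rewrite iterpD; apply: lt_le_trans (iterp_grow (j + k) hn).
have p1 : (1 : R) <= 2 ^+ j by rewrite exprn_ege1// ler1n.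
have p2 : 0 < (2 : R) ^+ k by rewrite exprn_gt0.
move: hk; rewrite exprVn ltr_pdivrMr// mul1r => hk.
have H1 : 2 ^+ k <= 2 ^+ (j + k) * N (it n z).
  rewrite exprD -mulrA -[X in X <= _]mul1r; apply: ler_pM => //.
  by apply: ler_peMr; [exact: ltW|exact: le_trans r1 (ltW hn)].
by have := ler_norm B; lra.
Qed.

Lemma escapes_open z : escapes r z ->
  exists2 e : R, 0 < e & forall x, N (x - z) < e -> escapes r x.
Proof.
move=> [n hn]; have e0 : 0 < N (it n z) - r by rewrite subr_gt0.
have [e e1 he] := ccont_iterp n z e0; exists e => // x /he hx; exists n.
by have := normc_subl (it n z) (it n x); rewrite normc_subC; lra.
Qed.

(** The escaping points of the connected set S form a nonempty, open and relatively closed subset,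
    hence all of S. *)
Lemma fatou_inf_escapes (z : CC R) : fatou_inf q z -> escapes r z.
Proof.
move=> [S [r' [SF [Sc [Sz Sr]]]]].
pose E : set (CC R) := [set x | escapes r x].
have Eo : open E.
  by rewrite openE => x Ex; apply/nbhs_CC; exact: escapes_open.
suff SE : S `&` E = S by have : S z by []; rewrite -SE => -[].
have unbounded (t : nat -> nat) x B : (forall k, (t k < t k.+1)%N) -> E x ->
    exists k0, forall k, (k0 <= k)%N -> B < N (it (t k) x).
  move=> tm /escapes_bound => /(_ B)[n hn]; exists n => k nk; apply: hn.
  apply: leq_trans nk _; elim: k => // k IH; exact: leq_ltn_trans IH (tm k).
apply: Sc.
- pose M := Num.max r' r + 1; pose w : C := M%:C.
  have [h1 h2] : r' < M /\ r < M.
    by rewrite /M !ltr_pwDr ?le_max ?lexx ?orbT.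
  have nw : N w = M by rewrite normc_real ger0_norm//; have := r1; lra.
  exists w; split; last by exists 0%N; change (r < N w); rewrite nw.
  by apply: Sr => /=; change (r' < N w); rewrite nw.
- by exists E.
- exists (closure E); first exact: closed_closure.
  apply/seteqP; split=> x [Sx Ex]; split=> //; first exact: subset_closure.
  have [U [Uo [Ux nf]]] := SF x Sx.
  (* At a limit point x of escaping points, a subsequence of iterates converging near x would be
     bounded at escaping points close to x. So it diverges locally uniformly and x escapes;
     singletons suffice as compact sets. *)
  have [t [tm [[g lu]|ld]]] := nf id.
    have [w [Ew Uw]] := Ex U (open_nbhs_nbhs (conj Uo Ux)).
    have wU : [set w] `<=` U by move=> _ ->.
    have [m _ hm] := lu _ (@compact_set1 _ w) wU 1 ltr01.
    have [k0 hk] := unbounded t w (N (g w) + 1) tm Ew.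
    have := hm (maxn m k0) (leq_maxl _ _) w erefl.
    have := hk (maxn m k0) (leq_maxr _ _).
    change (cabs (it (t (maxn m k0)) w - g w)) with (N ((it (t (maxn m k0)) w : C) - g w)).
    have := normc_subl (it (t (maxn m k0)) w) (g w); rewrite /=; lra.
  have wU : [set x] `<=` U by move=> _ ->.
  have [m _ hm] := ld _ (@compact_set1 _ x) wU r.
  by exists (t m); exact: hm (leqnn m) x erefl.
Qed.

End Radius.
End Escape.

(** * The Poincare function at the repelling fixed point *)
Section Linearization.
Variable R : realType.
Local Notation C := R[i].
Local Notation N := (@Normc.normc R).
Local Notation Im := (@complex.Im R).
Variables (q q1 : {poly C}) (lam : R).
Hypothesis q_fact : q = q1 * 'X.
Hypothesis q1_0 : q1.[0] = lam%:C.
Hypothesis lam1 : 1 < lam.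
Let m := lam^-1.

Let lam0 : 0 < lam. Proof. exact: lt_trans lam1. Qed.
Let m0 : 0 < m. Proof. by rewrite invr_gt0. Qed.
Let m1 : m < 1. Proof. by rewrite invf_lt1. Qed.
Let lamm n : lam ^+ n * m ^+ n = 1.
Proof. by rewrite -exprMn divff ?expr1n// gt_eqF. Qed.

Lemma fixpoint_expansion : exists2 K : R, 0 <= K & forall (r : R) (x y : C), r <= 1 ->
  N x <= r -> N y <= r -> N (q.[x] - q.[y]) <= (lam + 2 * K * r) * N (x - y).
Proof.
have [K K0 h] := poly_ball_lip q1 1; exists K => // r x y r1 xr yr.
have z1 : N (0 : C) <= 1 by rewrite Normc.normc0.
have x1 := le_trans xr r1; have y1 := le_trans yr r1.
rewrite q_fact !hornerE.
have -> : q1.[x] * x - q1.[y] * y = lam%:C * (x - y) +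
  ((q1.[x] - lam%:C) * (x - y) + (q1.[x] - q1.[y]) * y) by ring.
apply: le_trans (normc_add _ _) _.
apply: le_trans (lerD (lexx _) (normc_add _ _)) _; rewrite !Normc.normcM.
rewrite normc_real gtr0_norm//.
have n0 := normc_ge0 (x - y).
have H1 : N (q1.[x] - lam%:C) <= K * r.
  rewrite -q1_0; apply: le_trans (h _ _ x1 z1) _.
  by rewrite subr0 ler_wpM2l.
have H2 : N (q1.[x] - lam%:C) * N (x - y) <= K * r * N (x - y) by rewrite ler_wpM2r.
have H3 : N (q1.[x] - q1.[y]) * N y <= K * N (x - y) * r.
  by apply: ler_pM; rewrite ?normc_ge0 ?h.
lra.
Qed.

(* Along backward orbits tending to the repelling fixed point the errors of the
   linear approximation are summable, so distances scale like [lam ^ n]. *)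
Lemma backward_distortion : exists2 K : R, 0 < K & forall a b : nat -> C,
  (forall n, q.[a n.+1] = a n) -> (forall n, q.[b n.+1] = b n) ->
  (forall n, N (a n) <= m ^+ n) -> (forall n, N (b n) <= m ^+ n) ->
  forall n, N (a 0%N - b 0%N) <= K * (lam ^+ n * N (a n - b n)).
Proof.
have [K K0 h] := fixpoint_expansion.
have dm : 0 < 1 - m by rewrite subr_gt0.
(* Chosen so that 2 K m^j = k (m^j - m^(j+1)): the product of the distortion factors telescopes and
   stays below exp k. *)
pose k := 2 * K / (1 - m).
have k0 : 0 <= k by rewrite divr_ge0 ?mulr_ge0// ltW.
exists (expR k) => [|a b qa qb am bm n]; first exact: expR_gt0.
have step j : N (a j - b j) <= lam * expR (k * (m ^+ j - m ^+ j.+1)) * N (a j.+1 - b j.+1).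
  rewrite -{1}qa -{1}qb; apply: le_trans (h (m ^+ j.+1) _ _ _ (am _) (bm _)) _.
    by rewrite exprn_ile1// ltW.
  rewrite ler_wpM2r ?normc_ge0//.
  have -> : lam + 2 * K * m ^+ j.+1 = lam * (1 + 2 * K * m ^+ j.+2).
    by rewrite (exprS m j.+1); set u := m ^+ j.+1; rewrite /m; field; rewrite gt_eqF.
  rewrite ler_pM2l//; apply: le_trans (expR_ge1Dx _); rewrite lerD2l.
  have -> : k * (m ^+ j - m ^+ j.+1) = 2 * K * m ^+ j.
    by rewrite exprS /k; field; rewrite gt_eqF.
  have m00 : 0 <= m by exact: ltW.
  have mm : m * m <= 1 by rewrite mulr_ile1// ltW.
  by rewrite ler_wpM2l ?mulr_ge0// !exprS mulrA ler_piMl ?exprn_ge0.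
have main j : N (a 0%N - b 0%N) <= expR (k * (1 - m ^+ j)) * (lam ^+ j * N (a j - b j)).
  elim: j => [|j IH]; first by rewrite !expr0 subrr mulr0 expR0 !mul1r.
  apply: le_trans IH _.
  have -> : k * (1 - m ^+ j.+1) = k * (1 - m ^+ j) + k * (m ^+ j - m ^+ j.+1) by ring.
  rewrite expRD -mulrA ler_pM2l ?expR_gt0// [lam ^+ j.+1]exprSr.
  have := step j; rewrite -(@ler_pM2l _ (lam ^+ j)) ?exprn_gt0// => /le_trans; apply.
  by rewrite le_eqVlt; apply/orP; left; apply/eqP; ring.
apply: le_trans (main n) _; apply: ler_wpM2r.
  by apply: mulr_ge0 (normc_ge0 _); apply: exprn_ge0; exact: ltW.
rewrite ler_expR -[leRHS]mulr1; apply: ler_wpM2l => //.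
by rewrite gerBl exprn_ge0// ltW.
Qed.

Variable Phi : C -> C.
Hypothesis Phi0 : Phi 0 = 0.
Hypothesis Phi_d0 : is_cdif Phi 0 1.
Hypothesis Phi_eq : forall z, Phi (lam%:C * z) = q.[Phi z].

Lemma Phi_near0 (e : R) : 0 < e -> exists2 d : R, 0 < d &
  forall x, N x < d -> N (Phi x - x) <= e * N x.
Proof.
move=> /Phi_d0[d d0 h]; exists d => // x xd.
by have := h x; rewrite !subr0 Phi0 mul1r subr0; apply.
Qed.

Lemma scaled_small (M e : R) : 0 < e -> exists n, M * m ^+ n < e.
Proof.
move=> e0.
have lp : 0 < lam - 1 by rewrite subr_gt0.
exists (Num.bound (`|M| / e / (lam - 1))); set n := Num.bound _.
have bern (j : nat) : j%:R * (lam - 1) <= lam ^+ j.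
  elim: j => [|j IH]; first by rewrite mul0r.
  have : 1 <= lam ^+ j by rewrite exprn_ege1// ltW.
  rewrite exprS mulrSr; nra.
have h : `|M| / e / (lam - 1) < n%:R.
  by apply: archi_boundP; rewrite !divr_ge0// ltW.
have Mp : 0 < lam ^+ n by rewrite exprn_gt0.
rewrite exprVn ltr_pdivrMr//; apply: le_lt_trans (ler_norm _) _.
rewrite mulrC -ltr_pdivrMr//; apply: lt_le_trans (bern n).
by rewrite -ltr_pdivrMr.
Qed.

(** The way the functional equation globalizes local facts: every z is lam^n times a point of the
    disc of radius r. *)
Lemma scale_ind (P : C -> Prop) (r : R) : 0 < r ->
  (forall z, N z < r -> P z) -> (forall z, P z -> P (lam%:C * z)) -> forall z, P z.
Proof.
move=> r0 near step z; have [n hn] := scaled_small (N z) r0.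
have ind j w : P ((m ^+ j)%:C * w) -> P w.
  elim: j w => [|j IH] w; first by rewrite expr0 mul1r.
  move=> h; apply: IH; have := step _ h.
  rewrite exprS mulrA -rmorphM /= mulrA divff ?gt_eqF// mul1r; exact.
apply: (ind n); apply: near.
by rewrite Normc.normcM normc_real ger0_norm ?exprn_ge0 ?ltW// mulrC.
Qed.

Lemma Phi_back (x : C) n : Phi ((m ^+ n)%:C * x) = q.[Phi ((m ^+ n.+1)%:C * x)].
Proof.
by rewrite -Phi_eq mulrA -rmorphM /= exprS mulrA divff ?gt_eqF// mul1r.
Qed.

Lemma Phi_orbit_small : exists2 r : R, 0 < r &
  forall x, N x < r -> forall n, N (Phi ((m ^+ n)%:C * x)) <= m ^+ n.
Proof.
(* Near 0, |Phi(x)| <= 2 |x|; starting with |x| < 1/2 gives the bound m^n exactly. *)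
have [d d0 h] := Phi_near0 ltr01; exists (Num.min d (1 / 2)).
  by rewrite lt_min d0 divr_gt0.
move=> x; rewrite lt_min => /andP[xd xh] n.
have mn : 0 < m ^+ n by rewrite exprn_gt0.
have mn1 : m ^+ n <= 1 by rewrite exprn_ile1// ltW.
have e : N ((m ^+ n)%:C * x) = m ^+ n * N x by rewrite Normc.normcM normc_real gtr0_norm.
have x0 := normc_ge0 x.
have := h ((m ^+ n)%:C * x); rewrite e mul1r => /(_ _)H.
have {}H := H (le_lt_trans (ler_piMl x0 mn1) xd).
by have := normc_subl (Phi ((m ^+ n)%:C * x)) ((m ^+ n)%:C * x); rewrite e; nra.
Qed.

(** Near 0, [backward_distortion] applies to the backward orbits Phi(m^n x) and Phi(m^n y). As
    Phi(X) = X + o(X), their distance is m^n (|x - y| + small), and lam^n cancels m^n; letting the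
    small term vanish gives the Lipschitz constant K. *)
Lemma Phi_llip z : llip Phi z.
Proof.
have [K K0 h] := backward_distortion.
have [r r0 hr] := Phi_orbit_small.
apply: (@scale_ind _ r) z => // [z zr|z hz]; last first.
  have l0 : lam%:C != 0 :> C by rewrite -normc_gt0 normc_real gtr0_norm.
  apply: (llip_eq ltr01 (g := fun x => q.[Phi (m%:C * x)])) => [x _|].
    by rewrite -Phi_eq mulrA -rmorphM /= divff ?gt_eqF// mul1r.
  apply: (llip_comp (g := fun x => Phi (m%:C * x))); last exact: llip_poly.
  apply: (llip_comp (g := fun x => m%:C * x)).
    exists 1 => //; exists 1 => // x y _ _.
    rewrite -mulrBr Normc.normcM normc_real (ger0_norm (ltW m0)).
    by apply: ler_wpM2r; [exact: normc_ge0|exact: ltW].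
  by rewrite mulrA -rmorphM /= mulVf ?gt_eqF// mul1r.
exists K; first exact: ltW.
have s0 : 0 < r - N z by rewrite subr_gt0.
exists (r - N z) => // x y hx hy.
have xr : N x < r by have := normc_subl x z; lra.
have yr : N y < r by have := normc_subl y z; lra.
apply/ler_addgt0Pr => e e0.
(* The error left after rescaling is K e' (|x| + |y|); this denominator for e' makes it at most e,
   and the added 1 keeps it nonzero. *)
have p0 : 0 < K * (N x + N y) + 1 by rewrite ltr_wpDl// mulr_ge0 ?addr_ge0 ?normc_ge0 ?ltW.
have e1 : 0 < e / (K * (N x + N y) + 1) by rewrite divr_gt0.
have [d d0 hd] := Phi_near0 e1.
have [n hn] := scaled_small (N x + N y) d0.
have := h _ _ (fun n => esym (Phi_back x n)) (fun n => esym (Phi_back y n)) (hr x xr) (hr y yr) n.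
rewrite expr0 rmorph1 !mul1r => /le_trans; apply.
have mn : 0 < m ^+ n by rewrite exprn_gt0.
have ex w : N ((m ^+ n)%:C * w) = m ^+ n * N w by rewrite Normc.normcM normc_real gtr0_norm.
set X := (m ^+ n)%:C * x; set Y := (m ^+ n)%:C * y.
have hX : N (Phi X - X) <= e / (K * (N x + N y) + 1) * (m ^+ n * N x).
  by rewrite -ex; apply: hd; rewrite ex; have := normc_ge0 y; nra.
have hY : N (Phi Y - Y) <= e / (K * (N x + N y) + 1) * (m ^+ n * N y).
  by rewrite -ex; apply: hd; rewrite ex; have := normc_ge0 x; nra.
have hXY : N (X - Y) = m ^+ n * N (x - y) by rewrite -ex mulrBr.
set e' := e / _ in e1 hX hY.
have B : N (Phi X - Phi Y) <= m ^+ n * (N (x - y) + e' * (N x + N y)).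
  have -> : Phi X - Phi Y = (Phi X - X) + ((X - Y) - (Phi Y - Y)) by ring.
  apply: le_trans (normc_add _ _) _.
  apply: le_trans (lerD (lexx _) (normc_sub _ _)) _; rewrite hXY; lra.
apply: (@le_trans _ _ (K * (lam ^+ n * (m ^+ n * (N (x - y) + e' * (N x + N y)))))).
  by rewrite ler_pM2l// ler_pM2l// exprn_gt0.
rewrite (mulrA (lam ^+ n)) lamm mul1r mulrDr lerD2l mulrCA /e' mulrAC.
by rewrite ler_pdivrMr// ler_pM2l// lerDl.
Qed.

Lemma Phi_cdif (r : R) : 0 < r -> (forall z, N z < r -> cdif Phi z) -> forall z, cdif Phi z.
Proof.
move=> r0 h; apply: (@scale_ind _ r) => // z hz.
apply: (cdif_eq ltr01 (g := fun x => q.[Phi (m%:C * x)])) => [x _|].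
  by rewrite -Phi_eq mulrA -rmorphM /= divff ?gt_eqF// mul1r.
apply: (cdif_comp (g := fun x => Phi (m%:C * x))); last exact: cdif_poly.
apply: (cdif_comp (g := fun x => m%:C * x)).
  by apply: cdifM (cdif_cst _ _) (@cdif_id _ _).
by rewrite mulrA -rmorphM /= mulVf ?gt_eqF// mul1r.
Qed.

(** For real z the sequence Phi(m^n z) and its conjugate are both backward orbits of q, asymptotic
    to the same real numbers m^n z. Their distance is o(m^n), so [backward_distortion] makes their
    starting points equal. *)
Lemma Phi_real : (forall z, q.[conjc z] = conjc q.[z]) -> forall x : R, Im (Phi x%:C) = 0.
Proof.
move=> qreal x; suff : forall z : C, Im z = 0 -> Im (Phi z) = 0 by apply.
have [K K0 h] := backward_distortion.
have [r r0 hr] := Phi_orbit_small.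
apply: (@scale_ind _ r) => // [z zr z0|z IH].
  apply: conj_fixed; apply/eqP; rewrite eq_sym -subr_eq0; apply/eqP.
  apply: normc_small => e e0.
  have p0 : 0 < K * (2 * N z) + 1 by rewrite ltr_wpDl// !mulr_ge0 ?normc_ge0 ?ltW.
  have e1 : 0 < e / (K * (2 * N z) + 1) by rewrite divr_gt0.
  have [d d0 hd] := Phi_near0 e1.
  have [n hn] := scaled_small (N z) d0.
  pose a k := Phi ((m ^+ k)%:C * z).
  have := h a (fun k => conjc (a k)) (fun k => esym (Phi_back z k)) _ (hr z zr) _ n.
  have -> : a 0%N = Phi z by rewrite /a expr0 rmorph1 mul1r.
  move=> /(_ _ _)/le_trans; apply.
  - by move=> k; rewrite qreal /a -Phi_back.
  - by move=> k; rewrite normc_conj; exact: hr.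
  have ex w : N ((m ^+ n)%:C * w) = m ^+ n * N w.
    by rewrite Normc.normcM normc_real gtr0_norm// exprn_gt0.
  have hX : N (a n - (m ^+ n)%:C * z) <= e / (K * (2 * N z) + 1) * (m ^+ n * N z).
    by rewrite -ex; apply: hd; rewrite ex mulrC.
  have cz : conjc ((m ^+ n)%:C * z) = (m ^+ n)%:C * z.
    by apply: real_conj; rewrite ImZ z0 mulr0.
  set e' := e / _ in e1 hX; set X := (m ^+ n)%:C * z in hX cz.
  have B : N (a n - conjc (a n)) <= m ^+ n * (e' * (2 * N z)).
    have -> : a n - conjc (a n) = (a n - X) - conjc (a n - X) by rewrite conjB cz; ring.
    by apply: le_trans (normc_sub _ _) _; rewrite normc_conj; lra.
  apply: (@le_trans _ _ (K * (lam ^+ n * (m ^+ n * (e' * (2 * N z)))))).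
    by rewrite ler_pM2l// ler_pM2l// exprn_gt0.
  rewrite (mulrA (lam ^+ n)) lamm mul1r mulrCA /e' mulrAC.
  by rewrite ler_pdivrMr// ler_pM2l// lerDl.
rewrite ImZ => /eqP; rewrite mulf_eq0 gt_eqF//= => /eqP/IH i0.
by rewrite Phi_eq; apply: conj_fixed; rewrite -qreal real_conj.
Qed.

End Linearization.

(** * The logarithm of the Boettcher coordinate *)
Section Limits.
Variable R : realType.
Local Notation C := R[i].
Local Notation N := (@Normc.normc R).

Definition tends (u : nat -> C) (l : C) := forall e : R, 0 < e ->
  exists n0, forall n, (n0 <= n)%N -> N (u n - l) < e.

Lemma tends_unique u l l' : tends u l -> tends u l' -> l = l'.
Proof.
move=> h h'; apply/eqP; rewrite -subr_eq0; apply/eqP; apply: normc_small => e e0.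
have e2 : 0 < e / 2 by rewrite divr_gt0.
have [n hn] := h _ e2; have [m hm] := h' _ e2.
have := normc_dist l (u (maxn n m)) l'; rewrite [N (l - u _)]normc_subC.
have := hn _ (leq_maxl n m); have := hm _ (leq_maxr n m).
lra.
Qed.

Lemma tends_geom u l (K : R) : (forall k, N (u k - l) <= K * 2^-1 ^+ k) -> tends u l.
Proof.
move=> h e e0; have [k hk] := exp2_small `|K| e0; exists k => n kn.
apply: le_lt_trans (h n) _; apply: le_lt_trans hk.
apply: (@le_trans _ _ (`|K| * 2^-1 ^+ n)).
  by apply: ler_wpM2r; rewrite ?exprn_ge0 ?invr_ge0 ?ler_norm.
by rewrite ler_wpM2l// ler_wiXn2l// ?invr_ge0// invf_le1// ler1n.
Qed.

Lemma tends_shift u l m : tends (fun n => u (n + m)%N) l -> tends u l.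
Proof.
move=> h e /h[n hn]; exists (n + m)%N => k nk.
have mk : (m <= k)%N := leq_trans (leq_addl _ _) nk.
by have := hn (k - m)%N; rewrite subnK//; apply; rewrite leq_subRL// addnC.
Qed.

Lemma tends_shiftR u l m : tends u l -> tends (fun n => u (n + m)%N) l.
Proof.
move=> h e /h[n hn]; exists n => k nk; apply: hn.
exact: leq_trans nk (leq_addr _ _).
Qed.

Lemma tendsM u l c : tends u l -> tends (fun n => c * u n) (c * l).
Proof.
move=> h e e0; have p0 : 0 < N c + 1 by rewrite ltr_wpDl ?normc_ge0.
have [n hn] := h _ (divr_gt0 e0 p0); exists n => k /hn.
rewrite ltr_pdivlMr// -mulrBr Normc.normcM => hk; apply: le_lt_trans hk.
by rewrite mulrC ler_wpM2l ?normc_ge0// lerDl.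
Qed.

Lemma tendsB u v l m : tends u l -> tends v m -> tends (fun n => u n - v n) (l - m).
Proof.
move=> hu hv e e0; have e2 : 0 < e / 2 by rewrite divr_gt0.
have [n hn] := hu _ e2; have [k hk] := hv _ e2.
exists (maxn n k) => j; rewrite geq_max => /andP[/hn nj /hk kj].
rewrite (_ : u j - v j - (l - m) = (u j - l) - (v j - m)); last by ring.
by apply: le_lt_trans (normc_sub _ _) _; lra.
Qed.

Lemma llip_affine (f : C -> C) z k b : llip f z -> llip (fun x => k * f x + b) z.
Proof.
move=> [K K0 [d d0 h]]; exists (N k * K); first by rewrite mulr_ge0 ?normc_ge0.
exists d => // x y hx hy.
rewrite (_ : _ - _ = k * (f x - f y)); last by ring.
by rewrite Normc.normcM -mulrA ler_wpM2l ?normc_ge0 ?h.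
Qed.

End Limits.

(** * The logarithm of c psi and the limit of its rescalings *)

Section Core.
Variable R : realType.
Local Notation C := R[i].
Local Notation N := (@Normc.normc R).
Local Notation Re := (@complex.Re R).
Local Notation Im := (@complex.Im R).
Variables (q : {poly C}) (d : nat) (a c : R).
Hypothesis d2 : (2 <= d)%N.
Hypothesis size_q : size q = d.+1.
Hypothesis lead_q : lead_coef q = a%:C.
Hypothesis q0 : q.[0] = 0.
Hypothesis c0 : 0 < c.
Hypothesis c_root : c ^+ d.-1 = a.
Variables (psi : C -> C) (h : R).
Hypothesis h0 : 0 < h.
Hypothesis psi_eq : forall w, psi (w + 1) = q.[psi w].
Hypothesis psi_cdif : forall w, cdif psi w.
Hypothesis psi_llip : forall w, llip psi w.
Hypothesis psi_real : forall x : R, Im (psi x%:C) = 0.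
Hypothesis psi_pos : forall x : R, 0 < Re (psi x%:C).
Variable r : R.
Hypothesis r1 : 1 <= r.
Hypothesis grow : forall x, r < N x -> 2 * N x <= N q.[x].
Let S (w : C) := `|Im w| < h.
Hypothesis psi_esc : forall w, S w -> escapes q r (psi w).

Let S_open w : S w -> exists2 e : R, 0 < e & forall x, N (x - w) < e -> S x.
Proof.
move=> Sw; exists (h - `|Im w|); first by rewrite subr_gt0.
move=> x hx; rewrite /S; have := ler_Im (x - w); rewrite ImB.
have := ler_normD (Im w) (Im x - Im w); rewrite addrC subrK; lra.
Qed.

Let S_star w (t : R) : S w -> 0 <= t <= 1 -> S (t%:C * w).
Proof.
move=> Sw /andP[t0 t1]; rewrite /S ImZ normrM ger0_norm//.
by apply: le_lt_trans Sw; rewrite ler_piMl.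
Qed.

Let S_real (x : R) : S x%:C.
Proof. by rewrite /S /= normr0. Qed.

Let Im_addn w n : Im (w + n%:R) = Im w.
Proof. by rewrite ImD -(rmorph_nat (real_complex R)) /= addr0. Qed.

Let Re_addn w n : Re (w + n%:R) = Re w + n%:R.
Proof. by rewrite ReD -(rmorph_nat (real_complex R)). Qed.

Let S_addn w n : S w -> S (w + n%:R).
Proof. by rewrite /S Im_addn. Qed.

Let psi_cont w : ccont psi w.
Proof. exact: cdif_cont. Qed.

Let psi_addn w n : psi (w + n%:R) = iterp q n (psi w).
Proof.
elim: n => [|n IH]; first by rewrite addr0.
by rewrite mulrSr addrA psi_eq IH.
Qed.

Let psi_neq0 w : S w -> psi w != 0.
Proof.
move=> /psi_esc[n]; apply: contraTneq => ->.
have -> : iterp q n 0 = 0 by elim: n => // n IH; rewrite iterpS IH.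
by rewrite Normc.normc0 -leNgt; apply: le_trans r1.
Qed.

Let H w := c%:C * psi w.

Let cC0 : c%:C != 0 :> C.
Proof. by rewrite -normc_gt0 normc_real gtr0_norm. Qed.

Let H_neq0 w : S w -> H w != 0.
Proof. by move=> Sw; rewrite mulf_neq0 ?psi_neq0. Qed.

Let H_cont w : ccont H w.
Proof. by apply: ccontM (ccont_cst _ _) (psi_cont w). Qed.

Let H0 : Cexp (ln (c * Re (psi 0)))%:C = H 0.
Proof.
have p := psi_pos 0; rewrite rmorph0 in p.
have i := psi_real 0; rewrite rmorph0 in i.
by rewrite Cexp_real lnK ?posrE ?mulr_gt0// rmorphM /H [psi 0 in RHS]Im0_real.
Qed.

Lemma log_psi_exists : exists L : C -> C,
  [/\ forall w, S w -> ccont L w, forall w, S w -> Cexp (L w) = H w &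
      forall x : R, Im (L x%:C) = 0].
Proof.
have S0 : S 0 by have := S_real 0; rewrite rmorph0.
have [L [L0 hL]] := log_branch_exists S_open S_star (fun w _ => H_cont w) H_neq0 H0 S0.
exists L; split=> [w /hL[]//|w /hL[]//|x].
(* On the real axis the conjugate of [L] is another continuous logarithm of the real function [H],
   with the same real value at 0. *)
apply: conj_fixed; symmetry.
have seg (t : R) : 0 + t%:C * (x%:C - 0) = (t * x)%:C by rewrite add0r subr0 rmorphM.
apply: (@lift_unique R L (fun w => conjc (L w)) 0).
- by move=> t _; rewrite seg; have [] := hL _ (S_real (t * x)).
- move=> t _ e e0; rewrite seg; have [cL _] := hL _ (S_real (t * x)).
  by have [e' e'0 k] := cL e e0; exists e' => // y /k; rewrite -conjB normc_conj.
- move=> t _; rewrite seg Cexp_conj; have [_ ->] := hL _ (S_real (t * x)).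
  rewrite real_conj// /H [psi _]Im0_real -?rmorphM//.
- by rewrite L0 real_conj.
Qed.

Variable L : C -> C.
Hypothesis L_cont : forall w, S w -> ccont L w.
Hypothesis L_exp : forall w, S w -> Cexp (L w) = H w.
Hypothesis L_real : forall x : R, Im (L x%:C) = 0.

Let L_local w : S w -> exists2 e : R, 0 < e &
  forall x, N (x - w) < e -> L x = L w + Log (H x / H w).
Proof.
move=> Sw; have [e e0 he] := S_open Sw.
by apply: (log_branch_local e0 _ (L_cont Sw) (H_cont w)) => x /he /L_exp.
Qed.

Let L_cdif w : S w -> cdif L w.
Proof.
move=> Sw; have [e e0 he] := L_local Sw.
apply: cdif_eq e0 he _; apply: cdifD (cdif_cst _ _) _.
apply: (cdif_comp (g := fun x => H x / H w)).
  by apply: cdifM (cdif_cst _ _); apply: cdifM (cdif_cst _ _) (psi_cdif w).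
by rewrite divff ?H_neq0//; apply: cdif_Log; rewrite /= ltr01.
Qed.

Let L_llip w : S w -> llip L w.
Proof.
move=> Sw; have [e e0 he] := L_local Sw.
apply: (llip_eq e0 (g := fun x => 1 * Log (H x / H w) + L w)) => [x hx|].
  by rewrite mul1r addrC he.
apply: llip_affine; apply: (llip_comp (g := fun x => H x / H w)).
  apply: (llip_eq ltr01 (g := fun x => (c%:C / H w) * psi x + 0)) => [x _|].
    by rewrite addr0 /H mulrAC.
  exact: llip_affine.
by rewrite divff ?H_neq0//; apply: llip_Log; rewrite /= ltr01.
Qed.

(** Since psi(w + k) is the k-th iterate at psi(w), it suffices to escape uniformly from the compact
    rectangle 0 <= Re w <= 1, |Im w| <= h'. Beyond r moduli only grow, so a bound reached once near
    a point persists for all later iterates. *)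
Lemma psi_large (h' B : R) : h' < h -> exists n : nat, forall w,
  `|Im w| <= h' -> n%:R <= Re w -> B < N (psi w).
Proof.
move=> hh; pose B' := Num.max B r.
have Br : r <= B' by rewrite le_max lexx orbT.
have BB : B <= B' by rewrite le_max lexx.
pose Q n w := forall m, (n <= m)%N -> B' < N (iterp q m (psi w)).
have Qmono n m w : (n <= m)%N -> Q n w -> Q m w.
  by move=> nm k j mj; apply: k; exact: leq_trans mj.
have Qloc w : S w -> exists n, exists2 e : R, 0 < e & forall x, N (x - w) < e -> Q n x.
  move=> Sw; have [n hn] := escapes_bound r1 grow B' (psi_esc Sw).
  have e0 : 0 < N (iterp q n (psi w)) - B' by rewrite subr_gt0 hn.
  have cc : ccont (fun x => iterp q n (psi x)) w.
    by apply: (ccont_comp (g := psi)) => //; exact: ccont_iterp.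
  have [e ep he] := cc _ e0.
  exists n; exists e => // x /he hx m nm.
  have Bn : B' < N (iterp q n (psi x)).
    have := normc_subl (iterp q n (psi w)) (iterp q n (psi x)).
    by rewrite normc_subC; lra.
  rewrite -(subnK nm) iterpD; apply: (lt_le_trans Bn).
  apply: le_trans (iterp_grow grow _ (le_lt_trans Br Bn)).
  by rewrite ler_peMl ?normc_ge0// exprn_ege1// ler1n.
have [n hn] : exists n, forall x, 0 <= x <= 1 -> forall y, - h' <= y <= h' -> Q n (x +i* y).
  apply: (segment_uniform (P := fun n x => forall y, - h' <= y <= h' -> Q n (x +i* y))).
    by move=> n m t nm k y /k; exact: Qmono.
  move=> x _.
  (* Compactness in y for a fixed x, with an index that also serves all x' near x; compactness in x
     is the enclosing argument. *)
  have [n hn] : exists n, forall y, - h' <= y <= h' ->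
      forall x', `|x' - x| < n.+1%:R^-1 -> Q n (x' +i* y).
    apply: (segment_uniform (P := fun n y =>
      forall x', `|x' - x| < n.+1%:R^-1 -> Q n (x' +i* y))).
      move=> n m t nm k x' hx'; apply: (Qmono _ _ _ nm); apply: k.
      exact: lt_le_trans hx' (inv_natS_le _ nm).
    move=> y hy; have Sw : S (x +i* y).
      by rewrite /S /=; apply: le_lt_trans hh; rewrite ler_norml.
    have [n1 [e e0 he]] := Qloc _ Sw.
    have e2 : 0 < e / 2 by rewrite divr_gt0.
    have [n2 hn2] := inv_nat_small e2.
    exists (maxn n1 n2); exists (e / 2) => // y' hy' x' hx'.
    apply: Qmono (leq_maxl n1 n2) _; apply: he.
    apply: le_lt_trans (normc_le_sum _) _; rewrite ReB ImB /=.
    have := lt_trans (lt_le_trans hx' (inv_natS_le _ (leq_maxr n1 n2))) hn2; lra.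
  exists n; exists n.+1%:R^-1; first by rewrite invr_gt0.
  by move=> x' hx' y hy; exact: hn.
exists n => w hI hR; pose k := Num.truncn (Re w).
have R0 : 0 <= Re w by apply: le_trans hR.
have /andP[k1 k2] : k%:R <= Re w < k.+1%:R by exact: truncn_itv.
have nk : (n <= k)%N by rewrite -ltnS -(ltr_nat R); exact: le_lt_trans k2.
have := hn (Re w - k%:R) _ (Im w) _ k nk.
have -> : (Re w - k%:R) +i* Im w = w - k%:R.
  by apply: complex_ext; rewrite ?ReB ?ImB -(rmorph_nat (real_complex R)) /= ?subr0.
rewrite -psi_addn subrK => /(_ _ _)hB; apply: le_lt_trans BB _; apply: hB.
  by rewrite subr_ge0 k1/= lerBlDr -natr1 addrC in k2 *; apply: ltW.
by rewrite -ler_norml.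
Qed.

Let Q := revpoly q d.
Let u w := Q.[(psi w)^-1].
Let Ln (n : nat) w : C := d%:R^-1 ^+ n * L (w + n%:R).

Let dn0 : d%:R != 0 :> C.
Proof. by rewrite -normc_gt0 normc_nat ltr0n (leq_trans _ d2). Qed.

Let d_inv n : N (d%:R^-1 ^+ n) <= 2^-1 ^+ n.
Proof.
rewrite normc_exp Normc.normcV normc_nat lerXn2r ?nnegrE ?invr_ge0//.
by rewrite lef_pV2 ?posrE ?ltr0n ?ler_nat// (leq_trans _ d2).
Qed.

Let psi_inv w : S w -> (psi w)^-1 = c%:C * Cexp (- L w).
Proof.
move=> Sw; rewrite CexpN L_exp// /H invfM mulrA divff ?mul1r//.
Qed.

(** Measuring differences of 1/psi by differences of [L], rather than by x - z, closes the recursion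
    in [Ln_diff_step]. *)
Let inv_psi_lip x z (M : R) : S x -> S z -> N (psi x)^-1 <= M -> N (psi z)^-1 <= M ->
  N ((psi x)^-1 - (psi z)^-1) <= 3 * M * N (L x - L z).
Proof.
wlog xz : x z / Re (- L x) <= Re (- L z).
  move=> W Sx Sz xM zM; case: (leP (Re (- L x)) (Re (- L z))) => [|/ltW] le.
    exact: W.
  by have := W z x le Sz Sx zM xM; rewrite (normc_subC (psi z)^-1) (normc_subC (L z)).
move=> Sx Sz _; rewrite !psi_inv// -mulrBr !Normc.normcM normc_real gtr0_norm// normc_Cexp.
move=> zM; apply: le_trans (ler_wpM2l (ltW c0) (Cexp_lip xz)) _.
rewrite (_ : - L x - - L z = - (L x - L z)); last by ring.
rewrite normc_opp mulrA ler_wpM2r ?normc_ge0//; lra.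
Qed.

Let Ln_add n m w : Ln (n + m) w = d%:R^-1 ^+ m * Ln n (w + m%:R).
Proof. by rewrite /Ln mulrA -exprD addnC -addrA natrD. Qed.

Lemma Ln_cdif n w : S w -> cdif (Ln n) w.
Proof.
move=> Sw; apply: cdifM (cdif_cst _ _) _; apply: (cdif_comp (g := fun x => x + n%:R)).
  by apply: cdifD (@cdif_id _ _) (cdif_cst _ _).
exact/L_cdif/S_addn.
Qed.

(** * Estimates on a right half-strip where psi is large *)

Section Region.
Variables (K h' X B : R).
Hypothesis K0 : 0 < K.
Hypothesis Q_near1 : forall x y : C, N x <= 1 -> N y <= 1 ->
  N (Q.[x] - Q.[y]) <= K * N (x - y) /\ N (Q.[x] - 1) <= K * N x.
Hypotheses (h'0 : 0 <= h') (hh : h' < h) (B1 : 1 <= B) (rB : r <= B) (KB : 48 * K <= B).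
Let V w := `|Im w| <= h' /\ X <= Re w.
Hypothesis VB : forall w, V w -> B < N (psi w).

Let V_S w : V w -> S w.
Proof. by move=> [w1 _]; exact: le_lt_trans hh. Qed.

Let V_addn w n : V w -> V (w + n%:R).
Proof.
by move=> [w1 w2]; rewrite /V Im_addn Re_addn; split=> //; apply: le_trans w2 _; rewrite lerDl.
Qed.

Let psi_grow w n : V w -> 2 ^+ n * N (psi w) <= N (psi (w + n%:R)).
Proof.
by move=> Vw; rewrite psi_addn; apply: (iterp_grow grow); exact: le_lt_trans rB (VB Vw).
Qed.

Let psi_gt0 w : V w -> 0 < N (psi w).
Proof. by move=> /VB; apply: lt_trans; exact: lt_le_trans B1. Qed.

Let psi_inv_le1 w : V w -> N (psi w)^-1 <= 1.
Proof.
move=> Vw; rewrite Normc.normcV invf_le1 ?psi_gt0//.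
exact: le_trans B1 (ltW (VB Vw)).
Qed.

Let psi_inv_small w : V w -> K * N (psi w)^-1 < 1 / 8.
Proof.
move=> Vw; rewrite Normc.normcV ltr_pdivrMr ?psi_gt0//.
by have := VB Vw; have := KB; have := K0; lra.
Qed.

Let u_near w : V w -> N (u w - 1) <= K * N (psi w)^-1.
Proof.
move=> Vw; have [_] := Q_near1 (psi_inv_le1 Vw) (psi_inv_le1 Vw); exact.
Qed.

Let u_near8 w : V w -> N (u w - 1) < 1 / 8.
Proof. by move=> Vw; exact: le_lt_trans (u_near Vw) (psi_inv_small Vw). Qed.

Let u_pos w : V w -> 0 < Re (u w).
Proof.
move=> /u_near8 h8; rewrite (_ : u w = 1 + (u w - 1)); last by ring.
by apply: Re_near1; lra.
Qed.

Let u_cont w : V w -> ccont u w.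
Proof.
move=> Vw; apply: (ccont_comp (g := fun x => (psi x)^-1) (f := horner Q)).
  by apply: ccontV (psi_cont w); rewrite -normc_gt0 psi_gt0.
exact: cdif_cont (cdif_poly _ _).
Qed.

Let Log_u_bound w : V w -> N (Log (u w)) <= 4 * (K * N (psi w)^-1).
Proof.
move=> Vw; rewrite (_ : u w = 1 + (u w - 1)); last by ring.
apply: le_trans (Log1D_le _) _; first by have := u_near8 Vw; lra.
by rewrite ler_pM2l// u_near.
Qed.

Let psi_stepE w : V w -> psi (w + 1) = a%:C * psi w ^+ d * u w.
Proof.
move=> Vw; rewrite psi_eq (revpolyE size_q) ?lead_q//.
by rewrite -normc_gt0 psi_gt0.
Qed.

(** Solving [psi_stepE] for u exhibits it as a quotient of real numbers. *)
Let u_real (x : R) : X <= x -> Im (u x%:C) = 0.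
Proof.
move=> Xx; have Vx : V x%:C by split; rewrite /= ?normr0.
have ac : a%:C != 0 :> C by rewrite -lead_q (lead_neq0 size_q).
have p0 : psi x%:C != 0 by rewrite -normc_gt0 psi_gt0.
have -> : u x%:C = psi (x + 1)%:C / (a%:C * psi x%:C ^+ d).
  rewrite rmorphD rmorph1 psi_stepE// mulrC mulKf//.
  by rewrite mulf_neq0// expf_neq0.
rewrite [psi x%:C]Im0_real// [psi _%:C in X in X / _]Im0_real//.
by rewrite -rmorphXn -rmorphM -fmorphV -rmorphM.
Qed.

(** As c a = c^d, both sides are continuous logarithms of c psi(w + 1) along the segment from the
    real point X to w. At X both are real, and a real logarithm is determined by the modulus. *)
Let L_step w : V w -> L (w + 1) = d%:R * L w + Log (u w).
Proof.
move=> Vw; have [w1 w2] := Vw.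
have seg (t : R) : 0 <= t <= 1 -> V (X%:C + t%:C * (w - X%:C)).
  move=> /andP[t0 t1]; rewrite /V ImD ReD ImZ ReZ ImB ReB /= subr0 add0r normrM.
  rewrite (ger0_norm t0); split; first by apply: le_trans w1; rewrite ler_piMl.
  by rewrite lerDl mulr_ge0// subr_ge0.
have S1 x : V x -> S (x + 1) by move=> /V_S Sx; exact: (S_addn 1 Sx).
have E x : V x -> Cexp (L (x + 1)) = Cexp (d%:R * L x + Log (u x)).
  move=> Vx; have Sx := V_S Vx.
  rewrite CexpD Cexp_nat Cexp_Log ?u_pos// !L_exp//; last exact: S1.
  rewrite /H psi_stepE// exprMn -c_root -[in RHS](prednK (ltnW d2)) exprS.
  by rewrite prednK ?(ltnW d2)// rmorphXn; ring.
apply: (@lift_unique R (fun x => L (x + 1)) (fun x => d%:R * L x + Log (u x)) X%:C).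
- move=> t /seg Vt; apply: (ccont_comp (g := fun x => x + 1)).
    by apply: ccontD (@ccont_id _ _) (ccont_cst _ _).
  by apply: L_cont; exact: S1.
- move=> t /seg Vt; apply: ccontD.
    by apply: ccontM (ccont_cst _ _) (L_cont (V_S Vt)).
  by apply: (ccont_comp (g := u)); [exact: u_cont|exact/ccont_Log/u_pos].
- by move=> t /seg; exact: E.
- have VX : V X%:C by split; rewrite /= ?normr0.
  have I1 : Im (L (X%:C + 1)) = 0.
    by have := L_real (X + 1); rewrite rmorphD rmorph1.
  have I2 : Im (d%:R * L X%:C + Log (u X%:C)) = 0.
    rewrite ImD -(rmorph_nat (real_complex R)) ImZ L_real mulr0 add0r.
    by rewrite [u _]Im0_real ?u_real// Log_real_Im.
  apply: complex_ext; last by rewrite I1 I2.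
  apply: expR_inj; rewrite -!normc_Cexp; congr N; exact: E.
Qed.

Let Ln_step k w : V w -> Ln k.+1 w - Ln k w = d%:R^-1 ^+ k.+1 * Log (u (w + k%:R)).
Proof.
move=> Vw; rewrite /Ln mulrSr addrA L_step; last exact: V_addn.
by rewrite exprSr; set e := d%:R^-1 ^+ k; field.
Qed.

Let Ln_cauchy w k : V w -> N (Ln k.+1 w - Ln k w) <= 2 * (K * N (psi w)^-1) * 2^-1 ^+ k.
Proof.
move=> Vw; rewrite Ln_step// Normc.normcM.
have H1 : N (Log (u (w + k%:R))) <= 4 * (K * N (psi w)^-1).
  apply: le_trans (Log_u_bound (V_addn k Vw)) _.
  rewrite ler_pM2l// ler_pM2l// !Normc.normcV lef_pV2 ?posrE ?psi_gt0//; last exact: V_addn.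
  apply: le_trans (psi_grow k Vw); rewrite ler_peMl ?normc_ge0//.
  by rewrite exprn_ege1// ler1n.
apply: le_trans (ler_pM (normc_ge0 _) (normc_ge0 _) (d_inv _) H1) _.
rewrite exprS; lra.
Qed.

Lemma Ln_limit w : V w -> exists l, forall k,
  N (Ln k w - l) <= 8 * (K * N (psi w)^-1) * 2^-1 ^+ k.
Proof.
move=> Vw; have [l hl] := cseq_cauchy (fun k => Ln_cauchy k Vw).
by exists l => k; apply: le_trans (hl k) _; lra.
Qed.

(** A relative estimate: passing from k to k + 1 changes the difference by a small fraction of
    itself. The decay 2^-k comes from |psi(w + k)| >= 2^k |psi(w)|, so the accumulated factor stays
    bounded. *)
Let Ln_diff_step x z k : V x -> V z ->
  N ((Ln k.+1 x - Ln k.+1 z) - (Ln k x - Ln k z)) <=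
  4^-1 * 2^-1 ^+ k * N (Ln k x - Ln k z).
Proof.
move=> Vx Vz.
have -> : (Ln k.+1 x - Ln k.+1 z) - (Ln k x - Ln k z) =
    (Ln k.+1 x - Ln k x) - (Ln k.+1 z - Ln k z) by ring.
rewrite !Ln_step// -mulrBr.
set x' := x + k%:R; set z' := z + k%:R.
have Vx' : V x' by exact: V_addn.
have Vz' : V z' by exact: V_addn.
have small w : V w -> N (psi (w + k%:R))^-1 <= 2^-1 ^+ k / B.
  move=> Vw; have p1 := psi_gt0 (V_addn k Vw).
  have p2 : 0 < 2 ^+ k * B by rewrite mulr_gt0 ?exprn_gt0// (lt_le_trans _ B1).
  rewrite Normc.normcV exprVn -invfM lef_pV2 ?posrE//.
  by apply: le_trans (psi_grow k Vw); rewrite ler_pM2l ?exprn_gt0// ltW// VB.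
have H1 : N (Log (u x') - Log (u z')) <= 8 * N (u x' - u z').
  have := @Log_lip R 1 (u x') (u z'); rewrite /= divr1; apply.
  - exact: ltr01.
  - exact: u_near8.
  - exact: u_near8.
have [H2 _] := Q_near1 (psi_inv_le1 Vx') (psi_inv_le1 Vz').
have H3 := inv_psi_lip (V_S Vx') (V_S Vz') (small x Vx) (small z Vz).
have e : Ln k x - Ln k z = d%:R^-1 ^+ k * (L x' - L z') by rewrite mulrBr.
rewrite e exprS !Normc.normcM -mulrA.
have D0 := normc_ge0 (d%:R^-1 ^+ k : C).
have D1 : N (d%:R^-1 : C) <= 2^-1 by have := d_inv 1; rewrite !expr1.
(* Origin of 48: the constants 8 of [Log_lip] and 3 of [inv_psi_lip] multiply to 24, and 24/48 =
   1/2. The remaining half of the factor 1/4 is d^-1 <= 1/2. *)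
have tB : K * (2^-1 ^+ k / B) <= 48^-1 * 2^-1 ^+ k.
  rewrite mulrCA mulrC ler_wpM2r ?exprn_ge0 ?invr_ge0//.
  rewrite ler_pdivrMr; last exact: lt_le_trans B1.
  by have := KB; lra.
have H4 : N (Log (u x') - Log (u z')) <= 2^-1 * 2^-1 ^+ k * N (L x' - L z').
  apply: (le_trans H1); apply: (@le_trans _ _ (8 * (K * (3 * (2^-1 ^+ k / B) * N (L x' - L z'))))).
    by rewrite ler_pM2l//; apply: (le_trans H2); rewrite ler_pM2l.
  have := ler_wpM2r (normc_ge0 (L x' - L z')) tB; lra.
apply: le_trans (ler_pM (normc_ge0 _) _ D1 (ler_wpM2l D0 H4)) _.
  by rewrite mulr_ge0 ?normc_ge0.
lra.
Qed.

Lemma Ln_diff_limit x z lx lz : V x -> V z ->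
  tends (Ln ^~ x) lx -> tends (Ln ^~ z) lz ->
  forall k, N ((lx - lz) - (Ln k x - Ln k z)) <= 2 * N (L x - L z) * 2^-1 ^+ k.
Proof.
move=> Vx Vz tx tz; pose D k := Ln k x - Ln k z.
have D0 : D 0%N = L x - L z by rewrite /D /Ln !expr0 !mul1r !addr0.
(* Strengthened from the factor 2: with |D k| <= 2 |D 0| a step adds at most 2^-(k+1) |D 0|, exactly
   the increase of the right-hand side. *)
have bound k : N (D k) <= (2 - 2^-1 ^+ k) * N (D 0%N).
  elim: k => [|k IH]; first by rewrite expr0; have := normc_ge0 (D 0%N); lra.
  have s := Ln_diff_step k Vx Vz; rewrite -!/(D _) in s.
  have p0 : 0 <= (2^-1 : R) ^+ k by rewrite exprn_ge0// invr_ge0.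
  have n0 := normc_ge0 (D 0%N).
  have t : N (D k.+1) <= N (D k.+1 - D k) + N (D k).
    by have := normc_add (D k.+1 - D k) (D k); rewrite subrK.
  rewrite exprS; have B2 : N (D k) <= 2 * N (D 0%N) by nra.
  have B3 : 4^-1 * 2^-1 ^+ k * N (D k) <= 4^-1 * 2^-1 ^+ k * (2 * N (D 0%N)).
    by rewrite ler_wpM2l// mulr_ge0.
  lra.
have step k : N (D k.+1 - D k) <= (2^-1 * N (D 0%N)) * 2^-1 ^+ k.
  have p0 : 0 <= (2^-1 : R) ^+ k by rewrite exprn_ge0// invr_ge0.
  have s := Ln_diff_step k Vx Vz; rewrite -!/(D _) in s.
  have n0 := normc_ge0 (D 0%N).
  have B2 : N (D k) <= 2 * N (D 0%N) by have := bound k; nra.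
  have B3 : 4^-1 * 2^-1 ^+ k * N (D k) <= 4^-1 * 2^-1 ^+ k * (2 * N (D 0%N)).
    by rewrite ler_wpM2l// mulr_ge0.
  lra.
have [l hl] := cseq_cauchy step => k.
have -> : lx - lz = l.
  apply: tends_unique (tendsB tx tz) _.
  apply: (@tends_geom _ _ _ (2 * N (D 0%N))) => j; apply: le_trans (hl j) _; lra.
by rewrite normc_subC -/(D k) -D0; apply: le_trans (hl k) _; lra.
Qed.

End Region.

(** [C0] is a free lower bound for |psi|: it becomes e / c in the positivity proof and a growth
    radius in the decay proof. *)
Let region_exists (K C0 h' : R) : h' < h -> exists B (n : nat),
  [/\ 1 <= B, r <= B, 48 * K <= B, C0 <= B &
      forall w, `|Im w| <= h' /\ n%:R <= Re w -> B < N (psi w)].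
Proof.
move=> hh; pose B := Num.max 1 (Num.max r (Num.max (48 * K) C0)).
have [n hn] := psi_large B hh; exists B, n; split; last by move=> w [w1 w2]; exact: hn.
all: by rewrite /B !le_max lexx ?orbT.
Qed.

Let enter (n : nat) w : exists m : nat, n%:R <= Re (w + m%:R).
Proof.
exists (Num.bound (`|n%:R| + `|Re w|)); set m := Num.bound _.
have : `|n%:R| + `|Re w| < m%:R :> R by apply: archi_boundP; rewrite addr_ge0.
rewrite Re_addn; have := ler_norm (n%:R : R); have := ler_norm (- Re w).
rewrite normrN; lra.
Qed.

(* [G = lim d^-n L (w + n)]; in terms of the Boettcher coordinate [b] at infinity,
   [G = log (b (psi w))]. *)
Lemma log_boettcher_exists : exists G : C -> C,
  [/\ forall w, S w -> cdif G w,
      forall w, S w -> G (w + 1) = d%:R * G w,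
      forall x : R, Im (G x%:C) = 0,
      forall w, S w -> 0 < Re (G w) &
      forall h' M : R, h' < h -> 0 < M -> exists X K : R, forall w,
        `|Im w| <= h' -> X <= Re w -> N (L w - G w) <= K * expR (- (M * Re w))].
Proof.
have [K K0 Qn] := revpoly_near1 size_q.
(* Convergence is known only far to the right; an integer shift moves w there and merely multiplies
   the sequence by a power of d. *)
have limS w : S w -> exists l, tends (Ln ^~ w) l.
  move=> Sw; have [B [n [B1 rB KB _ VB]]] := region_exists K 0 Sw.
  have [m hm] := enter n w.
  have Vw : `|Im (w + m%:R)| <= `|Im w| /\ n%:R <= Re (w + m%:R) by rewrite Im_addn.
  have [l hl] := Ln_limit K0 Qn (normr_ge0 _) Sw B1 rB KB VB Vw.
  exists (d%:R^-1 ^+ m * l); apply: (@tends_shift _ _ _ m) => e e0.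
  have [k hk] := tendsM (d%:R^-1 ^+ m) (tends_geom hl) e0.
  by exists k => j /hk; rewrite Ln_add.
have /choice[G hG] : forall w, exists l, S w -> tends (Ln ^~ w) l.
  by move=> w; have [/limS[l hl]|nS] := pselect (S w); [exists l|exists 0].
have Geq w : S w -> G (w + 1) = d%:R * G w.
  move=> Sw; apply: tends_unique (hG _ (S_addn 1 Sw)) _ => e e0.
  have [k hk] := tendsM d%:R (tends_shiftR 1 (hG _ Sw)) e0.
  by exists k => j /hk; rewrite Ln_add expr1 mulVKf.
have Gn w n : S w -> G (w + n%:R) = d%:R ^+ n * G w.
  move=> Sw; elim: n => [|n IH]; first by rewrite addr0 mul1r.
  by rewrite mulrSr addrA Geq ?IH ?exprS ?mulrA//; exact: S_addn.
have Gbound (h' B : R) (n : nat) w : 0 <= h' -> h' < h -> 1 <= B -> r <= B -> 48 * K <= B ->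
    (forall w, `|Im w| <= h' /\ n%:R <= Re w -> B < N (psi w)) ->
    `|Im w| <= h' /\ n%:R <= Re w -> N (L w - G w) <= 8 * (K * N (psi w)^-1).
  move=> h'0 hh B1 rB KB VB Vw; have Sw : S w by case: Vw => w1 _; exact: le_lt_trans hh.
  have [l hl] := Ln_limit K0 Qn h'0 hh B1 rB KB VB Vw.
  rewrite (tends_unique (hG _ Sw) (tends_geom hl)).
  by have := hl 0%N; rewrite /Ln !expr0 mul1r addr0 mulr1.
exists G; split=> //.
- move=> w Sw; pose h' := (`|Im w| + h) / 2.
  have hh : h' < h by move: Sw; rewrite /S /h'; lra.
  have h'0 : 0 <= h' by have := normr_ge0 (Im w); have := h0; rewrite /h'; lra.
  have Iw : `|Im w| <= h' by move: Sw; rewrite /S /h'; lra.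
  have [B [n [B1 rB KB _ VB]]] := region_exists K 0 hh.
  (* One unit further than the half-strip requires, so that a ball of radius at most 1 about w + m
     stays inside; likewise h' lies midway between |Im w| and h. *)
  have [m hm] := enter n.+1 w.
  have Sm : S (w + m%:R) by exact: S_addn.
  have [KL KL0 [e e0 lip]] := L_llip Sm.
  suff Gm : cdif G (w + m%:R).
    have [e' e'0 he'] := S_open Sw.
    apply: (@cdif_eq _ _ (fun x => d%:R^-1 ^+ m * G (x + m%:R)) _ _ e'0) => [x /he' Sx|].
      by rewrite Gn// exprVn mulKf// expf_neq0.
    apply: cdifM (cdif_cst _ _) _; apply: (cdif_comp (g := fun x => x + m%:R)) => //.
    by apply: cdifD (@cdif_id _ _) (cdif_cst _ _).
  pose e1 := Num.min e (Num.min 1 ((h - `|Im w|) / 2)).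
  have e10 : 0 < e1 by rewrite !lt_min e0 ltr01 divr_gt0// subr_gt0.
  apply: (@cdif_limit _ G Ln _ (2 * KL) e1) => //; first by rewrite mulr_ge0.
    by move=> k; exact: Ln_cdif.
  have VW x : N (x - (w + m%:R)) < e1 -> `|Im x| <= h' /\ n%:R <= Re x.
    rewrite !lt_min => /and3P[_ x1 x2]; split.
      have := ler_Im (x - (w + m%:R)); rewrite ImB Im_addn.
      have := ler_normD (Im w) (Im x - Im w); rewrite addrC subrK /h'; lra.
    have := le_trans (ler_norm _) (ler_Re (w + m%:R - x)); rewrite ReB normc_subC.
    by move: hm; rewrite -natr1; lra.
  have Vw : `|Im (w + m%:R)| <= h' /\ n%:R <= Re (w + m%:R).
    by apply: VW; rewrite subrr Normc.normc0.
  move=> k x hx; have Vx := VW x hx.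
  have Sx : S x by case: Vx => x1 _; exact: le_lt_trans hh.
  apply: le_trans (Ln_diff_limit K0 Qn h'0 hh B1 rB KB VB Vx Vw (hG _ Sx) (hG _ Sm) k) _.
  have p0 : 0 <= (2^-1 : R) ^+ k by rewrite exprn_ge0// invr_ge0.
  have lx : N (L x - L (w + m%:R)) <= KL * N (x - (w + m%:R)).
    apply: lip; last by rewrite subrr Normc.normc0.
    by move: hx; rewrite lt_min => /andP[].
  by rewrite -!mulrA ler_pM2l// [leRHS](_ : _ = KL * N (x - (w + m%:R)) * 2^-1 ^+ k);
    [exact: ler_wpM2r|ring].
- move=> x; apply/eqP; apply: contraT; rewrite -normr_gt0 => i0.
  have [n hn] := hG _ (S_real x) _ i0.
  have := hn n (leqnn n); rewrite ltNge normc_subC => /negP[].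
  apply: le_trans (ler_Im _); rewrite ImB.
  suff -> : Im (Ln n x%:C) = 0 by rewrite subr0.
  rewrite /Ln -(rmorph_nat (real_complex R) d) -fmorphV -rmorphXn ImZ.
  by rewrite -(rmorph_nat (real_complex R)) -rmorphD L_real mulr0.
(* Far to the right |c psi| > e gives Re L > 1, while |L - G| <= 1; so Re G > 0 there, and G(w + m)
   = d^m G(w) brings the sign back to w. *)
- move=> w Sw; have [B [n [B1 rB KB CB VB]]] := region_exists K (expR 1 / c) Sw.
  have [m hm] := enter n w; set w' := w + m%:R in hm.
  have Vw : `|Im w'| <= `|Im w| /\ n%:R <= Re w' by rewrite Im_addn.
  have Sw' : S w' by exact: S_addn.
  have nB := VB _ Vw.
  have np : 0 < N (psi w') by lra.
  have gb := Gbound _ _ _ _ (normr_ge0 _) Sw B1 rB KB VB Vw.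
  have small : N (L w' - G w') <= 1.
    apply: (le_trans gb); rewrite Normc.normcV mulrA ler_pdivrMr//; lra.
  have big : 1 < Re (L w').
    rewrite -ltr_expR -normc_Cexp L_exp// /H Normc.normcM normc_real gtr0_norm//.
    rewrite mulrC -ltr_pdivrMr//; exact: le_lt_trans CB nB.
  have : 0 < Re (G w').
    by have := le_trans (ler_norm _) (ler_Re (L w' - G w')); rewrite ReB; lra.
  rewrite /w' Gn// -(rmorph_nat (real_complex R)) -rmorphXn ReZ pmulr_rgt0//.
  by rewrite exprn_gt0// ltr0n (leq_trans _ d2).
- move=> h' M hh M0; have [h'0|h'n] := leP 0 h'; last first.
    by exists 0, 0 => w hw; have := le_lt_trans hw h'n; rewrite ltNge normr_ge0.
  have [rA rA1 growA] := poly_growth d2 size_q (expR M).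
  have [B [n [B1 rB KB CB VB]]] := region_exists K rA hh.
  (* Write w = v + k with n <= Re v < n + 1. Each unit step multiplies |psi| by at least exp M, so
     |psi(w)| >= exp (M k), and k > Re w - (n + 1). *)
  exists n%:R, (8 * K * expR (M * n.+1%:R)) => w hI hR.
  apply: le_trans (Gbound _ _ _ _ h'0 hh B1 rB KB VB (conj hI hR)) _.
  pose k := Num.truncn (Re w - n%:R).
  have /andP[k1 k2] : k%:R <= Re w - n%:R < k.+1%:R by apply: truncn_itv; rewrite subr_ge0.
  pose v := w - k%:R.
  have vw : v + k%:R = w by rewrite subrK.
  have Vv j : `|Im (v + j%:R)| <= h' /\ n%:R <= Re (v + j%:R).
    have : `|Im v| <= h' /\ n%:R <= Re v.
      rewrite ImB ReB -(rmorph_nat (real_complex R)) /= subr0; split=> //; lra.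
    by rewrite Im_addn Re_addn => -[v1 v2]; split=> //; apply: (le_trans v2); rewrite lerDl.
  have psik j : expR (M * j%:R) <= N (psi (v + j%:R)).
    elim: j => [|j IH].
      by rewrite mulr0 expR0; apply: le_trans B1 (ltW (VB _ (Vv 0%N))).
    rewrite -natr1 mulrDr mulr1 expRD mulrSr addrA psi_eq mulrC.
    apply: le_trans (growA _ (le_lt_trans CB (VB _ (Vv j)))).
    by rewrite ler_pM2l ?expR_gt0.
  have := psik k; rewrite vw => pk.
  rewrite mulrA -[leRHS]mulrA ler_pM2l; last by rewrite mulr_gt0.
  rewrite -expRD Normc.normcV -[leRHS]invrK lef_pV2 ?posrE ?invr_gt0 ?expR_gt0//; last first.
    exact: lt_le_trans (expR_gt0 _) pk.
  rewrite -expRN; apply: le_trans pk; rewrite ler_expR opprD opprK -mulrN -mulrDr.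
  rewrite ler_pM2l//; move: k2; rewrite -!natr1; lra.
Qed.

End Core.

(** * Exponential parametrization of the Poincare function *)
Section Assembly.
Variable R : realType.
Local Notation C := R[i].
Local Notation N := (@Normc.normc R).
Local Notation Re := (@complex.Re R).
Local Notation Im := (@complex.Im R).

Lemma conjcD (x y : C) : conjc (x + y) = conjc x + conjc y.
Proof. by apply: complex_ext; case: x => a b; case: y => c d /=; ring. Qed.

Lemma conjcM (x y : C) : conjc (x * y) = conjc x * conjc y.
Proof. by apply: complex_ext; case: x => a b; case: y => c d /=; ring. Qed.

Lemma horner_real_conj (p : {poly R}) (z : C) :
  (map_poly (real_complex R) p).[conjc z] = conjc (map_poly (real_complex R) p).[z].
Proof.
elim/poly_ind: p => [|p c IH]; first by rewrite rmorph0 !horner0 real_conj.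
rewrite rmorphD rmorphM /= map_polyX map_polyC !hornerE IH conjcD conjcM.
by congr (_ + _); rewrite real_conj.
Qed.

Lemma real_trace_zero (f : C -> C) (x y : R) : (forall t : R, ccont f t%:C) -> x <= y ->
  0 < Re (f x%:C) -> Re (f y%:C) < 0 -> exists t : R, Re (f t%:C) = 0.
Proof.
move=> fc xy fx fy.
have cW : {within `[x, y], continuous (fun t : R => Re (f t%:C))}.
  apply: continuous_subspaceT => t; apply/cvgrPdist_lt => e e0.
  have [d d0 k] := fc t e e0.
  apply/nbhs_ballP; exists d => //= s; rewrite /ball/= distrC => st.
  rewrite -ReB; apply: le_lt_trans (ler_Re _) _; rewrite normc_subC; apply: k.
  by rewrite -rmorphB normc_real.
have [|t _ ft] := IVT xy cW (v := 0); last by exists t.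
by rewrite ge_min le_max (ltW fx) (ltW fy) orbT.
Qed.

Lemma real_root_pos (n : nat) (a : R) : (0 < n)%N -> 0 < a ->
  0 < real_root n a /\ real_root n a ^+ n = a.
Proof.
move=> n0 a0; have e : real_root n a = a `^ n%:R^-1.
  by rewrite /real_root gtr0_sg// mul1r gtr0_norm.
rewrite e; split; first exact: powR_gt0.
rewrite -powR_mulrn ?powR_ge0// -powRrM mulVf ?powRr1 ?ltW//.
by rewrite pnatr_eq0 -lt0n.
Qed.

Lemma llip_scale (k z : C) : llip (fun w => k * w) z.
Proof.
exists (N k); first exact: normc_ge0.
by exists 1 => // x y _ _; rewrite -mulrBr Normc.normcM.
Qed.

End Assembly.

(** * Escape, reality and positivity of psi *)

Section Parametrization.
Variable R : realType.
Local Notation C := R[i].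
Local Notation N := (@Normc.normc R).
Local Notation Re := (@complex.Re R).
Local Notation Im := (@complex.Im R).
Variables (q q1 : {poly C}) (lam : R) (d : nat) (Phi : C -> C) (r beta : R).
Hypothesis d2 : (2 <= d)%N.
Hypothesis size_q : size q = d.+1.
Hypothesis q_fact : q = q1 * 'X.
Hypothesis q1_0 : q1.[0] = lam%:C.
Hypothesis lam1 : 1 < lam.
Hypothesis Phi0 : Phi 0 = 0.
Hypothesis Phi_d0 : is_cdif Phi 0 1.
Hypothesis Phi_eq : forall z, Phi (lam%:C * z) = q.[Phi z].
Hypothesis r1 : 1 <= r.
Hypothesis grow : forall x, r < N x -> 2 * N x <= N q.[x].
Hypothesis sector_esc : forall z : C, z != 0 -> `|Arg z| < beta -> escapes q r z.

Let q0 : q.[0] = 0. Proof. by rewrite q_fact !hornerE. Qed.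

Let lam0 : 0 < lam. Proof. exact: lt_trans lam1. Qed.
Let lnlam0 : 0 < ln lam. Proof. exact: ln_gt0. Qed.

Lemma iterp0 n : iterp q n 0 = 0.
Proof. by elim: n => // n IH; rewrite iterpS IH. Qed.

Lemma not_escapes0 : ~ escapes q r 0.
Proof. by case=> n; rewrite iterp0 Normc.normc0 ltNge (le_trans ler01 r1). Qed.

(* A nonzero root of [q] is mapped to the fixed point 0, so it does not escape. *)
Lemma beta_le_pi : beta <= pi.
Proof.
rewrite leNgt; apply/negP => bpi.
have sq1 : size q1 = d.
  have q1n : q1 != 0.
    by apply/eqP => e; move: size_q; rewrite q_fact e mul0r size_poly0.
  by move: size_q; rewrite q_fact size_mulX// => -[].
have /closed_rootP[z0 /rootP rz] : size q1 != 1%N.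
  by rewrite sq1; move: d2; case: (d) => [|[|]].
have z0n : z0 != 0.
  apply/eqP => e; move: rz; rewrite e q1_0 => /(congr1 Re) /= l0.
  by move: lam0; rewrite l0 ltxx.
have qz : q.[z0] = 0 by rewrite q_fact !hornerE rz mul0r.
have [] := sector_esc z0n (le_lt_trans (Arg_le_pi _) bpi).
case=> [|n] hn.
  have := grow hn; rewrite qz Normc.normc0.
  have : r < N z0 by []. have := r1. lra.
have : escapes q r (iterp q 1 z0) by exists n; rewrite -iterpD addn1.
rewrite /iterp /= qz; exact: not_escapes0.
Qed.

Definition psi (w : C) : C := Phi (Cexp ((ln lam)%:C * w)).

Lemma psi_shift w : psi (w + 1) = q.[psi w].
Proof.
by rewrite /psi mulrDr mulr1 CexpD Cexp_real lnK ?posrE// mulrC Phi_eq.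
Qed.

Lemma Phi_iter n z : Phi z = iterp q n (Phi ((lam^-1 ^+ n)%:C * z)).
Proof.
elim: n z => [|n IH] z; first by rewrite expr0 rmorph1 mul1r.
rewrite (IH z) (Phi_back lam1 Phi_eq) -(addn1 n) iterpD.
by rewrite [iterp q 1 _]/= -addn1.
Qed.

(** For t = lam^-n exp(zeta) close to 0, Phi(t) = t (1 + v) with v small, so Phi(t) is still in the
    sector and escapes; psi(w) is the n-th iterate of that point. *)
Lemma psi_escapes w : `|Im w| < beta / ln lam -> escapes q r (psi w).
Proof.
rewrite ltr_pdivlMr// => hw; pose zeta := (ln lam)%:C * w.
have hz : `|Im zeta| < beta by rewrite /zeta ImZ normrM (gtr0_norm lnlam0) mulrC.
(* [Log1D_le] costs a factor 4, so the argument moves by at most half of the gap beta - |Im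
   zeta|. *)
have e0 : 0 < Num.min (1 / 2) ((beta - `|Im zeta|) / 8).
  by rewrite lt_min divr_gt0//= divr_gt0// subr_gt0.
have [del del0 hd] := Phi_near0 Phi0 Phi_d0 e0.
have [n hn] := scaled_small lam1 (N (Cexp zeta)) del0.
set t := (lam^-1 ^+ n)%:C * Cexp zeta.
have m0 : 0 < lam^-1 ^+ n by rewrite exprn_gt0// invr_gt0.
have mc : (lam^-1 ^+ n)%:C != 0 :> C by rewrite -normc_gt0 normc_real gtr0_norm.
have tn : t != 0 by rewrite mulf_neq0// Cexp_neq0.
have tE : t = Cexp ((ln (lam^-1 ^+ n))%:C + zeta).
  by rewrite CexpD Cexp_real lnK.
have Nt : N t < del by rewrite Normc.normcM normc_real gtr0_norm// mulrC.
pose v := Phi t / t - 1.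
have vE : Phi t = t * (1 + v) by rewrite /v; field.
have nv : N v <= Num.min (1 / 2) ((beta - `|Im zeta|) / 8).
  have -> : v = (Phi t - t) / t by rewrite /v; field.
  by rewrite Normc.normcM Normc.normcV ler_pdivrMr ?normc_gt0// hd.
move: nv; rewrite le_min => /andP[nv1 nv2].
have lv := Log1D_le nv1; have rv := Re_near1 nv1.
have PE : Phi t = Cexp ((ln (lam^-1 ^+ n))%:C + zeta + Log (1 + v)).
  by rewrite vE tE [in RHS]CexpD Cexp_Log.
have aE : `|Im ((ln (lam^-1 ^+ n))%:C + zeta + Log (1 + v))| < beta.
  rewrite !ImD /= add0r; apply: le_lt_trans (ler_normD _ _) _.
  have := ler_Im (Log (1 + v)); lra.
have [k hk] : escapes q r (Phi t).
  rewrite PE; apply: sector_esc; first exact: Cexp_neq0.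
  by rewrite Arg_Cexp//; exact: lt_le_trans beta_le_pi.
(* The visit at time k may precede time n; a bound for all late times also covers j + n. *)
have [j hj] := escapes_bound r1 grow r (ex_intro _ k hk).
by exists j; rewrite /psi (Phi_iter n) -iterpD; apply: hj; exact: leq_addr.
Qed.

Hypothesis q_real : forall z, q.[conjc z] = conjc q.[z].
Hypothesis beta0 : 0 < beta.
Hypothesis Phi_cdif : forall z, cdif Phi z.

Lemma psi_cdif w : cdif psi w.
Proof.
apply: (cdif_comp (g := fun w => Cexp ((ln lam)%:C * w))) => //.
apply: (cdif_comp (g := fun w => (ln lam)%:C * w)).
  by apply: cdifM (cdif_cst _ _) (@cdif_id _ _).
by eexists; exact: is_cdif_Cexp.
Qed.

Lemma psi_llip w : llip psi w.
Proof.
apply: (llip_comp (g := fun w => Cexp ((ln lam)%:C * w))).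
  apply: (llip_comp (g := fun w => (ln lam)%:C * w)); first exact: llip_scale.
  exact: llip_Cexp.
exact: (Phi_llip q_fact q1_0 lam1 Phi0 Phi_d0 Phi_eq).
Qed.

Lemma psi_real (x : R) : Im (psi x%:C) = 0.
Proof.
rewrite /psi -rmorphM Cexp_real.
exact: (Phi_real q_fact q1_0 lam1 Phi0 Phi_d0 Phi_eq q_real).
Qed.

(** On the real axis psi is real and never 0, because 0 does not escape; far to the left it is
    positive since Phi(t) ~ t, so the intermediate value theorem excludes negative values. *)
Lemma psi_pos (x : R) : 0 < Re (psi x%:C).
Proof.
have nz y : Re (psi y%:C) != 0.
  apply/eqP => r0; have : escapes q r (psi y%:C).
    by apply: psi_escapes; rewrite /= normr0 divr_gt0.
  have -> : psi y%:C = 0 by apply: complex_ext; rewrite ?r0 ?psi_real.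
  exact: not_escapes0.
rewrite ltNge le_eqVlt (negbTE (nz x)) /=; apply/negP => xneg.
have e2 : (0 : R) < 1 / 2 by rewrite divr_gt0.
have [del del0 hd] := Phi_near0 Phi0 Phi_d0 e2.
(* The first bound places y = log_lam t to the left of x, the second makes Phi(t) close to t. *)
pose t := Num.min (expR (ln lam * x)) (del / 2).
have t0 : 0 < t by rewrite lt_min expR_gt0 divr_gt0.
have td : t < del by rewrite /t gt_min; apply/orP; right; lra.
pose y := ln t / ln lam.
have yE : psi y%:C = Phi t%:C.
  rewrite /psi -rmorphM Cexp_real /y mulrC divfK ?gt_eqF// lnK//.
have yx : y <= x.
  by rewrite /y ler_pdivrMr// mulrC -ler_expR lnK// /t ge_min lexx.
have ypos : 0 < Re (psi y%:C).
  have nt : N t%:C = t by rewrite normc_real gtr0_norm.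
  have := hd t%:C; rewrite nt => /(_ td).
  have := le_trans (ler_norm _) (ler_Re (t%:C - Phi t%:C)).
  rewrite ReB normc_subC yE /=; lra.
have [s /eqP] := real_trace_zero (fun t => cdif_cont (psi_cdif t%:C)) yx ypos xneg.
by rewrite (negbTE (nz s)).
Qed.

(** The numbers y = psi(n) are positive and tend to infinity; in psi(n + 1) = a y^d Q(1/y) the last
    factor has positive real part once y is large, so a is positive. *)
Lemma lead_pos (a : R) : lead_coef q = a%:C -> 0 < a.
Proof.
move=> aE; have [K K0 hK] := revpoly_near1 size_q.
have E0 : escapes q r (psi 0).
  by apply: psi_escapes; rewrite /= normr0 divr_gt0.
have [n hn] := escapes_bound r1 grow (Num.max 1 (2 * K)) E0.
have psin (m : nat) : psi (m%:R)%:C = iterp q m (psi 0).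
  elim: m => [|m IH]; first by rewrite rmorph0.
  by rewrite -natr1 rmorphD rmorph1 psi_shift IH.
have := hn n (leqnn n); rewrite -psin gt_max => /andP[y1 y2].
have yE := Im0_real (psi_real n%:R); have y0 := psi_pos n%:R.
set y := psi _ in y1 y2 yE y0.
have yn : y != 0 by rewrite -normc_gt0; lra.
have iy : N y^-1 <= 1 by rewrite Normc.normcV invf_le1 ?normc_gt0// ltW.
have [_ k2] := hK _ _ iy iy.
have rpos : 0 < Re (revpoly q d).[y^-1].
  rewrite (_ : (revpoly q d).[y^-1] = 1 + ((revpoly q d).[y^-1] - 1)); last by ring.
  apply: Re_near1; apply: (le_trans k2); rewrite Normc.normcV ler_pdivrMr ?normc_gt0//; lra.
have := psi_pos (n%:R + 1); rewrite rmorphD rmorph1 psi_shift -/y.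
rewrite (revpolyE size_q yn) aE yE -rmorphXn -rmorphM -yE ReZ pmulr_lgt0// pmulr_lgt0//.
by rewrite exprn_gt0.
Qed.

End Parametrization.

Lemma clog_base_parts (R : realType) (lam : R) (z : R[i]) :
  complex.Re (clog_base lam z : R[i]) = ln (Normc.normc z) / ln lam /\
  complex.Im (clog_base lam z : R[i]) = Arg z / ln lam.
Proof.
have -> : (clog_base lam z : R[i]) = ((ln lam)^-1)%:C * (clog z : R[i]).
  by rewrite /clog_base fmorphV mulrC.
by rewrite ReZ ImZ mulrC [_^-1 * complex.Im _]mulrC.
Qed.

Unset Implicit Arguments.

Theorem theorem1 (R : realType) (p : {poly R}) (beta : R)
    (Phi : CC R -> CC R) :
  let d := (size p).-1 in            (* degree of p *)
  let lam := p`_1 in                 (* lambda = p'(0) *)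
  let q := map_poly (real_complex R) p in   (* p acting on C *)
  let rho := ln (d%:R : R) / ln lam in      (* rho = log_lambda d *)
  (2 <= d)%N -> p`_0 = 0 -> 1 < lam -> 0 < beta ->
  sector beta `<=` fatou_inf q ->
  (* Phi is the Poincare function: Phi(lam z) = p(Phi z), Phi 0 = 0, Phi'(0) = 1 *)
  Phi 0 = 0 ->
  (exists r : R, 0 < r /\ holo_on [set z | cabs z < r] Phi) ->
  is_derive (0 : CC R) 1 Phi 1 ->
  (forall z : CC R, Phi (lam%:C * z) = q.[Phi z]) ->
  entire Phi /\
  exists F : CC R -> CC R,
    holo_on (hstrip (beta / ln lam)) F /\
    (forall w, hstrip (beta / ln lam) w -> F (w + 1) = F w) /\
    (forall x : R, complex.Im (F x%:C) = 0) /\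
    (forall z, sector beta z ->
       0 < complex.Re (cpow z rho * F (clog_base lam z))) /\
    (forall eps M : R, 0 < eps -> 0 < M ->
      exists eta : CC R -> CC R,
        (* eta(z) = o(|z|^-M) uniformly as |z| -> oo in |arg z| <= beta - eps *)
        (forall delta : R, 0 < delta -> exists r0 : R, forall z : CC R,
            z != 0 -> `|Arg z| <= beta - eps -> r0 < cabs z ->
            cabs (eta z) <= delta * powR (cabs z) (- M)) /\
        (exists r1 : R, forall z : CC R,
            z != 0 -> `|Arg z| <= beta - eps -> r1 < cabs z ->
            Phi z = ((real_root d.-1 (lead_coef p))^-1)%:C *
                    cexp (cpow z rho * F (clog_base lam z) + eta z))).
Proof.
move=> d lam q rho d2 p0 lam1 beta0 sec Phi0 [r0 [r00 hol]] dPhi Phieq.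
have lam0 : 0 < lam by exact: lt_trans lam1.
have lnlam0 : 0 < ln lam by exact: ln_gt0.
have dpos : 0 < d%:R :> R by rewrite ltr0n (leq_trans _ d2).
have lnd0 : (d%:R : R) != 0 by rewrite gt_eqF.
have size_p : size p = d.+1 by rewrite /d prednK//; move: d2; rewrite /d; case: (size p).
have size_q : size q = d.+1 by rewrite size_map_poly.
have lead_q : lead_coef q = (lead_coef p)%:C by rewrite lead_coef_map.
have q_at0 : q.[0] = 0 by rewrite horner_coef0 coef_map p0.
have [q1 qf] : exists q1, q = q1 * 'X.
  have /factor_theorem[q1 e] : root q 0 by apply/rootP.
  by exists q1; rewrite e subr0.
have q1_0 : q1.[0] = lam%:C.
  have : q`_1 = lam%:C by rewrite coef_map.
  by rewrite qf coefMX /= horner_coef0.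
have q_real := @horner_real_conj R p.
have [r r1 grow] := poly_growth d2 size_q 2.
have sec_esc (z : R[i]) : z != 0 -> `|Arg z| < beta -> escapes q r z.
  by move=> z0 az; apply: (fatou_inf_escapes r1 grow); apply: sec; split.
have Phi_d0 : is_cdif (Phi : R[i] -> R[i]) 0 1 by exact: is_derive_cdif dPhi.
have Phi_near (z : R[i]) : Normc.normc z < r0 -> cdif (Phi : R[i] -> R[i]) z.
  by move=> zr; apply: derivable_cdif; exact: hol.
have PhiC := Phi_cdif lam1 Phieq r00 Phi_near.
split; first by move=> z; exact: cdif_derivable.
pose h := beta / ln lam.
have h0 : 0 < h by rewrite divr_gt0.
have esc := psi_escapes d2 size_q qf q1_0 lam1 Phi0 Phi_d0 Phieq r1 grow sec_esc.
have preal := psi_real qf q1_0 lam1 Phi0 Phi_d0 Phieq q_real.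
have ppos := psi_pos d2 size_q qf q1_0 lam1 Phi0 Phi_d0 Phieq r1 grow sec_esc q_real beta0 PhiC.
have a0 : 0 < lead_coef p.
  exact: (lead_pos d2 size_q qf q1_0 lam1 Phi0 Phi_d0 Phieq r1 grow sec_esc q_real beta0 PhiC).
have dm : (0 < d.-1)%N by rewrite -subn1 subn_gt0.
have [c0 cr] := real_root_pos dm a0.
set c := real_root d.-1 (lead_coef p) in c0 cr.
have pshift := psi_shift lam1 Phieq.
have pcdif := psi_cdif lam PhiC.
have pllip := psi_llip qf q1_0 lam1 Phi0 Phi_d0 Phieq.
have [L [Lc Le Lr]] := log_psi_exists q_at0 c0 h0 pcdif preal ppos r1 esc.
have [G [Gh Gs Gr Gp Ga]] := log_boettcher_exists d2 size_q lead_q q_at0 c0 cr h0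
  pshift pcdif pllip preal r1 grow esc Lc Le Lr.
(* At w = log_lam z the first factor is exactly the inverse of the principal power z^rho, so z^rho
   F(log_lam z) is G(log_lam z). *)
pose F (w : R[i]) : R[i] := Cexp (- (ln d%:R)%:C * w) * G w.
have FG (z : R[i]) : cpow z rho * F (clog_base lam z) = G (clog_base lam z).
  rewrite /F mulrA; change (cpow z rho) with (Cexp ((rho%:C : R[i]) * clog z)).
  rewrite -CexpD; have -> : (rho%:C : R[i]) * clog z + - (ln d%:R)%:C * clog_base lam z = 0.
    rewrite /clog_base /rho rmorphM fmorphV; ring.
  by rewrite Cexp0 mul1r.
have strip (z : R[i]) b : `|Arg z| <= b -> `|complex.Im (clog_base lam z : R[i])| <= b / ln lam.
  move=> zb; have [_ ->] := clog_base_parts lam z.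
  by rewrite normrM normfV (gtr0_norm lnlam0) ler_pM2r ?invr_gt0.
exists F; split=> [w hw|].
  apply: cdif_derivable; apply: cdifM (Gh _ hw).
  apply: (cdif_comp (g := fun w => - (ln d%:R)%:C * w)).
    by apply: cdifM (cdif_cst _ _) (@cdif_id _ _).
  by eexists; exact: is_cdif_Cexp.
split=> [w hw|].
  rewrite /F Gs// mulrDr mulr1 CexpD -rmorphN Cexp_real expRN lnK ?posrE//.
  by rewrite fmorphV rmorph_nat; field; rewrite -(rmorph_nat (real_complex R)) fmorph_eq0.
split=> [x|].
  by rewrite /F -rmorphN -rmorphM Cexp_real ImZ Gr mulr0.
split=> [z [z0 az]|].
  rewrite FG; apply: Gp; have [_ ->] := clog_base_parts lam z.
  by rewrite normrM normfV (gtr0_norm lnlam0) ltr_pM2r ?invr_gt0.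
move=> eps M eps0 M0.
(* With this remainder the formula is the identity exp L = c psi, valid at every z != 0 of the
   closed smaller sector; hence the second radius is 0. *)
exists (fun z => L (clog_base lam z) - G (clog_base lam z)); split.
  move=> delta delta0.
  have hh : (beta - eps) / ln lam < h by rewrite ltr_pM2r ?invr_gt0// gtrBl.
  (* One power more than required: O(|z|^-(M+1)) is below delta |z|^-M once |z| > |K| / delta. The
     factor ln lam converts Re w = ln |z| / ln lam. *)
  have M1 : 0 < (M + 1) * ln lam by rewrite mulr_gt0// addr_gt0.
  have [X [K hK]] := Ga _ _ hh M1.
  exists (Num.max (expR (X * ln lam)) (`|K| / delta)) => z z0 az.
  change (cabs z) with (Normc.normc z); rewrite gt_max => /andP[z1 z2].
  have nz : 0 < Normc.normc z by rewrite normc_gt0.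
  have [reE _] := clog_base_parts lam z.
  apply: le_trans (hK _ (strip _ _ az) _) _.
    rewrite reE ler_pdivlMr// -ler_expR lnK ?posrE//; exact: ltW.
  rewrite reE /powR gt_eqF//.
  have -> : - ((M + 1) * ln lam * (ln (Normc.normc z) / ln lam)) =
    - M * ln (Normc.normc z) + - ln (Normc.normc z) by field; rewrite gt_eqF.
  rewrite expRD mulrCA [leRHS]mulrC ler_wpM2l ?expR_ge0//.
  rewrite expRN lnK ?posrE// ler_pdivrMr//.
  apply: le_trans (ler_norm _) _; rewrite mulrC -ler_pdivrMr//; exact: ltW.
exists 0 => z z0 az _; rewrite FG addrC subrK.
have Sw : `|complex.Im (clog_base lam z : R[i])| < h.
  by apply: le_lt_trans (strip _ _ az) _; rewrite ltr_pM2r ?invr_gt0// gtrBl.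
change (cexp ?w) with (Cexp w); rewrite Le// mulrA fmorphV mulVf; last first.
  by rewrite fmorph_eq0 gt_eqF.
rewrite mul1r /psi; congr Phi.
have -> : (ln lam)%:C * (clog_base lam z : R[i]) = clog z.
  by rewrite /clog_base mulrC divfK// fmorph_eq0 gt_eqF.
by rewrite Cexp_clog.
Qed.
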